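(* (Expansion of $L$ in terms of action variables) Let $\alpha\in[0,1)$, $0<\beta_0<\beta_1<1$, $0<e_0<e_1<1$, $U_0:=[(-\beta_1,-\beta_0)\cup(\beta_0,\beta_1)]\times(e_0,e_1)$, and suppose $\mu_1>0$ is sufficiently small such that the map $\mathcal J_\alpha:(0,\mu_1)\times U_0\to\mathbb R^3$, $(\mu,\beta,e)\mapsto(j_1,j_2,j_3)$, is injective. Then $$\lambda=j_2-\frac{\alpha j_1}{j_2}+\frac{\alpha^2}{2j_2}\left(1-\frac{j_1^2}{j_2^2}\right)+\frac{\alpha j_1}{2j_2}\left[\frac1{j_3^2}+\frac{\alpha^2}{j_2^2}\left(1-\frac{j_1^2}{j_2^2}\right)\right]+\mathcal O(\mu^3)$$ for all $(j_1,j_2,j_3)$ lying in the image of $\mathcal J_\alpha$, where $\lambda$ and $\mu$ are the values corresponding to $(j_1,j_2,j_3)=\mathcal J_\alpha(\mu,\beta,e)$.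
   Context: Dimensionless description of bound timelike geodesics in the Kerr exterior ($\alpha=a_H/M_H$ rotation parameter, $\varepsilon=E/m$ energy, $\lambda=L/(M_Hm)$ with $L^2$ the Carter constant, $\lambda_z=L_z/(M_Hm)=\beta\lambda+\alpha\varepsilon$ azimuthal angular momentum, $x=r/M_H$). For $\beta\in(-1,1)$, $x>x_+:=1+\sqrt{1-\alpha^2}$, $\lambda>0$: $w_{\alpha,\beta,\lambda}(x)=\frac{\alpha\beta\lambda}{x^2}+\sqrt{(1-\frac2x+\frac{\alpha^2}{x^2})(1+\frac{\lambda^2}{x^2})}$. There is $\lambda_{ms}(\alpha,\beta)>0$ such that $w_{\alpha,\beta,\lambda}$ has no critical point for $0<\lambda<\lambda_{ms}$, while for $\lambda>\lambda_{ms}$ it has exactly two critical points, a local maximum $x_{max}$ and a local minimum $x_{min}>x_{max}$; write $\varepsilon_{max}=w_{\alpha,\beta,\lambda}(x_{max})$, $\varepsilon_{min}=w_{\alpha,\beta,\lambda}(x_{min})$. Let $\mathcal D_\alpha:=\{(\beta,\lambda,\varepsilon):-1<\beta<1,\lambda>\lambda_{ms}(\alpha,\beta),\varepsilon_{min}<\varepsilon<\min\{1,\varepsilon_{max}\}\}$. For $(\beta,\lambda,\varepsilon)\in\mathcal D_\alpha$ the turning points are the two solutions $x_1<x_2$ of $w_{\alpha,\beta,\lambda}(x)=\varepsilon$ in $(x_{max},\infty)$; $p>0$ and $e\in(0,1)$ are defined by $x_1=\frac p{1+e}$, $x_2=\frac p{1-e}$. The map $(\beta,\lambda,\varepsilon)\mapsto(\beta,p,e)$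 is a bijection from $\mathcal D_\alpha$ onto a set $\mathcal E_\alpha=\{-1<\beta<1,0<e<1,p>p_{ISO}(\alpha,\beta,e)\}$, so $\varepsilon,\lambda$ may be regarded as functions of $(\beta,p,e)\in\mathcal E_\alpha$. Put $\mu:=1/\sqrt p$; for $(\beta,e)\in U_0$ and $\mu>0$ small enough one has $(\beta,\mu^{-2},e)\in\mathcal E_\alpha$. Action variables: with $\mathcal R(x)=(\varepsilon x^2-\alpha\beta\lambda)^2-(x^2-2x+\alpha^2)(x^2+\lambda^2)$ and $k(\vartheta)=(\frac{\lambda_z}{\sin\vartheta}-\alpha\varepsilon\sin\vartheta)^2+\alpha^2\cos^2\vartheta$, and $\vartheta_1<\vartheta_2$ the solutions of $k(\vartheta)=\lambda^2$ in $(0,\pi)$, $j_1:=\lambda_z$, $\;j_2:=|\lambda_z|+\frac1\pi\int_{\vartheta_1}^{\vartheta_2}\sqrt{\lambda^2-k(\vartheta)}\,d\vartheta$, $\;j_3:=j_2+\frac1\pi\int_{x_1}^{x_2}\frac{\sqrt{\mathcal R(x)}}{x^2-2x+\alpha^2}\,dx$. (That is, $j_1=I_1/(M_Hm)$, $j_2=(|I_1|+I_2)/(M_Hm)$, $j_3=(|I_1|+I_2+I_3)/(M_Hm)$ for the action variables $I_1,I_2,I_3$ of the azimuthal, polar and radial motion.) $\mathcal J_\alpha$ is injective on $(0,\mu_1)\times U_0$ for $\mu_1>0$ small enough. $\mathcal O(\mu^n)$ is understood as $\mu\to0$, uniformly for $(\beta,e)\in U_0$. *)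

(* Defs.v *)
From Stdlib Require Export Reals ClassicalEpsilon.
From Coquelicot Require Export Coquelicot.
Open Scope R_scope.

(* Standard library [R] with Coquelicot.

   Bound timelike geodesics in the exterior of a Kerr black hole, in
   dimensionless variables: alpha = rotation parameter, eps = energy,
   lam = square root of the Carter constant, x = radius, and
   lambda_z = beta * lam + alpha * eps = azimuthal angular momentum. *)

Definition x_plus (alpha : R) : R := 1 + sqrt (1 - alpha ^ 2).

(* Only meaningful for x > x_plus alpha. *)
Definition w (alpha beta lam x : R) : R :=
  alpha * beta * lam / x ^ 2
  + sqrt ((1 - 2 / x + alpha ^ 2 / x ^ 2) * (1 + lam ^ 2 / x ^ 2)).

Definition critical_point (alpha beta lam x : R) : Prop :=
  x_plus alpha < x /\ is_derive (w alpha beta lam) x 0.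

Definition local_maximum (f : R -> R) (x : R) : Prop :=
  locally x (fun y => f y <= f x).

Definition local_minimum (f : R -> R) (x : R) : Prop :=
  locally x (fun y => f x <= f y).

Definition critical_pair (alpha beta lam xmax xmin : R) : Prop :=
  critical_point alpha beta lam xmax /\
  critical_point alpha beta lam xmin /\
  (forall x, critical_point alpha beta lam x -> x = xmax \/ x = xmin) /\
  local_maximum (w alpha beta lam) xmax /\
  local_minimum (w alpha beta lam) xmin /\
  xmax < xmin.

(* These conditions determine lms: for two candidates, the values of lam
   strictly between them would give both no and two critical points. *)
Definition is_lambda_ms (alpha beta lms : R) : Prop :=
  0 < lms /\
  (forall lam, 0 < lam < lms -> forall x, ~ critical_point alpha beta lam x) /\
  (forall lam, lms < lam ->
     exists xmax xmin, critical_pair alpha beta lam xmax xmin).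

Definition bound_domain (alpha beta lam eps : R) : Prop :=
  -1 < beta < 1 /\
  exists lms xmax xmin,
    is_lambda_ms alpha beta lms /\ lms < lam /\
    critical_pair alpha beta lam xmax xmin /\
    w alpha beta lam xmin < eps < Rmin 1 (w alpha beta lam xmax).

Definition radial_turning_points (alpha beta lam eps x1 x2 : R) : Prop :=
  exists xmax xmin,
    critical_pair alpha beta lam xmax xmin /\
    xmax < x1 /\ x1 < x2 /\
    w alpha beta lam x1 = eps /\ w alpha beta lam x2 = eps /\
    (forall x, xmax < x -> w alpha beta lam x = eps -> x = x1 \/ x = x2).

(* The graph of the map (beta, lam, eps) |-> (beta, p, e), where p is the
   semi-latus rectum and e the eccentricity. *)
Definition orbit_parameters (alpha beta lam eps p e : R) : Prop :=
  bound_domain alpha beta lam eps /\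
  0 < p /\ 0 < e < 1 /\
  radial_turning_points alpha beta lam eps (p / (1 + e)) (p / (1 - e)).

(* The image of that map. *)
Definition orbit_domain (alpha beta p e : R) : Prop :=
  exists lam eps, orbit_parameters alpha beta lam eps p e.

(* The inverse map, giving (lam, eps) as a function of (beta, p, e); the
   value is arbitrary outside orbit_domain. *)
Definition lambda_eps (alpha beta p e : R) : R * R :=
  epsilon (inhabits (0, 0))
    (fun q : R * R => orbit_parameters alpha beta (fst q) (snd q) p e).

Definition lambda_of (alpha beta p e : R) : R := fst (lambda_eps alpha beta p e).

Definition eps_of (alpha beta p e : R) : R := snd (lambda_eps alpha beta p e).

Definition lambda_z (alpha beta lam eps : R) : R := beta * lam + alpha * eps.

Definition radial_fun (alpha beta lam eps x : R) : R :=
  (eps * x ^ 2 - alpha * beta * lam) ^ 2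
  - (x ^ 2 - 2 * x + alpha ^ 2) * (x ^ 2 + lam ^ 2).

Definition polar_fun (alpha beta lam eps theta : R) : R :=
  (lambda_z alpha beta lam eps / sin theta - alpha * eps * sin theta) ^ 2
  + alpha ^ 2 * cos theta ^ 2.

Definition polar_turning_points (alpha beta lam eps th1 th2 : R) : Prop :=
  0 < th1 /\ th1 < th2 /\ th2 < PI /\
  polar_fun alpha beta lam eps th1 = lam ^ 2 /\
  polar_fun alpha beta lam eps th2 = lam ^ 2 /\
  (forall th, 0 < th < PI ->
     polar_fun alpha beta lam eps th = lam ^ 2 -> th = th1 \/ th = th2).

(* For parameters in bound_domain the two polar turning points exist whenever
   lambda_z <> 0; if they do not exist, the value is arbitrary. *)
Definition theta12 (alpha beta lam eps : R) : R * R :=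
  epsilon (inhabits (0, 0))
    (fun q : R * R => polar_turning_points alpha beta lam eps (fst q) (snd q)).

Definition action1 (alpha beta lam eps : R) : R := lambda_z alpha beta lam eps.

Definition action2 (alpha beta lam eps : R) : R :=
  Rabs (lambda_z alpha beta lam eps)
  + / PI * RInt (fun th => sqrt (lam ^ 2 - polar_fun alpha beta lam eps th))
             (fst (theta12 alpha beta lam eps))
             (snd (theta12 alpha beta lam eps)).

Definition action3 (alpha beta lam eps x1 x2 : R) : R :=
  action2 alpha beta lam eps
  + / PI * RInt (fun x => sqrt (radial_fun alpha beta lam eps x)
                          / (x ^ 2 - 2 * x + alpha ^ 2)) x1 x2.

(* The parameter mu stands for 1 / sqrt p. *)
Definition p_of (mu : R) : R := / mu ^ 2.

Definition action_map (alpha mu beta e : R) : R * R * R :=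
  let p := p_of mu in
  let lam := lambda_of alpha beta p e in
  let eps := eps_of alpha beta p e in
  (action1 alpha beta lam eps,
   action2 alpha beta lam eps,
   action3 alpha beta lam eps (p / (1 + e)) (p / (1 - e))).

Definition U0 (beta0 beta1 e0 e1 beta e : R) : Prop :=
  (- beta1 < beta < - beta0 \/ beta0 < beta < beta1) /\ e0 < e < e1.

(* Main.v *)
Require Import Defs.
From Stdlib Require Import Lra.

(* The polar integrand is [sqrt (a + d sin^2 th - lambda_z^2 / sin^2 th)] with
   [a = lam^2 + 2 alpha eps lambda_z - alpha^2] and
   [d = alpha^2 (1 - eps^2) = O(mu^2)].  For [d = 0] the integral is elementary,
   so monotonicity in [d] gives [a <= j2^2 <= a + d], that is
   [lam^2 = j2^2 - 2 alpha eps j1 + alpha^2 + O(mu^2)].  Factoring the radial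
   quartic through its roots [x1, x2] gives [lam] of order [1 / mu],
   [1 - eps^2] of order [mu^2], and compares the radial integral with the
   Keplerian one: [j3 = 1 / sqrt (1 - eps^2) + O(1)].  Hence
   [2 (1 - eps) = 1 / j3^2 + O(mu^3)], and [lam] is obtained by expanding the
   square root. *)

(** The orbit constants are known only through the turning-point equations, and the endpoints of the
    integrals move with them, so each integral is bracketed between closed forms instead of being
    expanded. The polar bracket is tight enough because its width in [j2 ^ 2] is
    [alpha ^ 2 * (1 - eps ^ 2)], and an error of order [mu ^ 2] in [lam ^ 2] costs only order
    [mu ^ 3] in [lam]. For [j3] a bounded error suffices: in [1 / j3 ^ 2] it becomes a relative
    error of order [mu] on a quantity of order [mu ^ 2], and the prefactor [alpha * j1 / (2 * j2)]
    is bounded. Two obstacles precede this: [lam * mu] has no a priori bound, and squaring the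
    turning-point equation loses the sign of [eps]. Uniformity comes from explicit constants: the
    factor of [mu ^ 3] is absolute, and only the threshold on [mu] depends on [beta0], [beta1] and
    [e1]. *)

(** * Closed forms of the two model integrals *)

Lemma is_RInt_Rmult (f : R -> R) (k a b l : R) :
  is_RInt f a b l -> is_RInt (fun x => k * f x) a b (k * l).
Proof. apply (is_RInt_scal (V := R_NormedModule)). Qed.

Lemma is_RInt_Rminus (f g : R -> R) (a b l l' : R) :
  is_RInt f a b l -> is_RInt g a b l' -> is_RInt (fun x => f x - g x) a b (l - l').
Proof. apply (is_RInt_minus (V := R_NormedModule)). Qed.

Lemma is_RInt_Rplus (f g : R -> R) (a b l l' : R) :
  is_RInt f a b l -> is_RInt g a b l' -> is_RInt (fun x => f x + g x) a b (l + l').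
Proof. apply (is_RInt_plus (V := R_NormedModule)). Qed.

Lemma one_plus_mult_pos (e q : R) : -1 < e < 1 -> -1 <= q <= 1 -> 0 < 1 + e * q.
Proof.
  intros He Hq.
  assert (H : Rabs (e * q) <= Rabs e * 1).
  { rewrite Rabs_mult. apply Rmult_le_compat_l; [apply Rabs_pos|].
    apply Rabs_le. lra. }
  assert (Rabs e < 1) by (apply Rabs_def1; lra).
  assert (H' := Rle_abs (- (e * q))). rewrite Rabs_Ropp in H'. lra.
Qed.

(** Both model integrals reduce to this one. The half-angle substitution gives the antiderivative
    [F]; since [s ^ 2 = 1 - e ^ 2], its arctangent has arguments [(1 + e) / s] and [- s / (1 + e)]
    at the two ends, negative reciprocals, so the arctangents differ by [PI / 2]. *)
Lemma is_RInt_inv_one_plus_sin (e : R) : -1 < e < 1 ->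
  is_RInt (fun phi => / (1 + e * sin phi)) (- (PI / 2)) (PI / 2)
    (PI / sqrt (1 - e ^ 2)).
Proof.
  intros He.
  assert (Hpi := PI_RGT_0).
  assert (Hs : 0 < sqrt (1 - e ^ 2)) by (apply sqrt_lt_R0; nra).
  set (s := sqrt (1 - e ^ 2)) in *.
  assert (Hss : s * s = 1 - e ^ 2) by (apply sqrt_sqrt; nra).
  set (F := fun phi => 2 / s * atan ((tan (phi / 2) + e) / s)).
  assert (HF : PI / s = minus (F (PI / 2)) (F (- (PI / 2)))).
  { change (PI / s = F (PI / 2) + - F (- (PI / 2))). unfold F.
    replace (PI / 2 / 2) with (PI / 4) by field.
    replace (- (PI / 2) / 2) with (- (PI / 4)) by field.
    rewrite tan_neg, tan_PI4.
    replace ((- (1) + e) / s) with (- / ((1 + e) / s)).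
    2: { apply (Rmult_eq_reg_r (s * (1 + e))); [|nra]. field_simplify; nra. }
    rewrite atan_opp, atan_inv by (apply Rdiv_lt_0_compat; lra).
    field; lra. }
  rewrite HF.
  apply (is_RInt_derive F).
  - intros phi Hphi. rewrite Rmin_left, Rmax_right in Hphi by lra.
    assert (Hc : 0 < cos (phi / 2)) by (apply cos_gt_0; lra).
    assert (Hsin := SIN_bound phi).
    unfold F.
    evar_last.
    + apply is_derive_scal. apply (is_derive_comp atan).
      * apply is_derive_atan.
      * apply (is_derive_ext (fun t => (sin (t / 2) / cos (t / 2) + e) / s)).
        reflexivity. auto_derive. lra. reflexivity.
    + replace (sin phi) with (2 * sin (phi / 2) * cos (phi / 2)) in *
        by (rewrite <- sin_2a; f_equal; field).
      unfold scal; simpl; unfold mult; simpl; unfold Rsqr, tan.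
      assert (Hsc := sin2_cos2 (phi / 2)). unfold Rsqr in Hsc.
      replace (phi * / 2) with (phi / 2) by reflexivity.
      set (S := sin (phi / 2)) in *. set (C := cos (phi / 2)) in *.
      assert (0 < 1 + e * (2 * S * C)) by (apply one_plus_mult_pos; lra).
      assert (Hd : (C * s) ^ 2 + (S + e * C) ^ 2 = 1 + e * (2 * S * C)).
      { replace ((C * s) ^ 2) with (C * C * (s * s)) by ring. rewrite Hss.
        replace (C * C) with (1 - S * S) by lra.
        replace ((S + e * C) ^ 2) with (S * S + 2 * e * S * C + e ^ 2 * (C * C)) by ring.
        replace (C * C) with (1 - S * S) by lra. ring. }
      apply (Rmult_eq_reg_r (1 + e * (2 * S * C))); [|lra].
      rewrite Rinv_l by lra. rewrite <- Hd at 1.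
      transitivity (S * S + C * C); [|exact Hsc].
      field. repeat split; lra.
  - intros phi _.
    apply (ex_derive_continuous (fun x => / (1 + e * sin x))).
    auto_derive. apply Rgt_not_eq, one_plus_mult_pos, SIN_bound. lra.
Qed.

(** Matching the pulled-back integrand with [h] only on the open interval allows the use of
    [cos phi > 0], which fails at the ends [- (PI / 2)] and [PI / 2]. *)
Lemma is_RInt_subst (f g dg h : R -> R) (a b a' b' l : R) :
  g a = a' -> g b = b' ->
  a <= b ->
  (forall x, a <= x <= b -> continuous f (g x)) ->
  (forall x, a <= x <= b -> is_derive g x (dg x) /\ continuous dg x) ->
  (forall x, a < x < b -> dg x * f (g x) = h x) ->
  is_RInt h a b l ->
  RInt f a' b' = l.
Proof.
  intros <- <- Hab Hf Hg Hh Hl.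
  rewrite <- (is_RInt_unique _ _ _ _ Hl).
  rewrite <- (RInt_comp f g dg a b).
  - apply RInt_ext. intros x Hx. rewrite Rmin_left, Rmax_right in Hx by lra.
    apply (Hh x Hx).
  - intros x Hx. rewrite Rmin_left, Rmax_right in Hx by lra. auto.
  - intros x Hx. rewrite Rmin_left, Rmax_right in Hx by lra. auto.
Qed.

(* Substitution x = m (1 + e sin phi), where m is the mean of x1 and x2. *)
Lemma RInt_radial_base (x1 x2 : R) : 0 < x1 < x2 ->
  RInt (fun x => sqrt ((x2 - x) * (x - x1)) / x) x1 x2
  = PI * ((x1 + x2) / 2 - sqrt (x1 * x2)).
Proof.
  intros Hx.
  assert (Hpi := PI_RGT_0).
  set (m := (x1 + x2) / 2). set (e := (x2 - x1) / (x1 + x2)).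
  assert (He : 0 < e < 1).
  { unfold e; split. apply Rdiv_lt_0_compat; lra.
    apply Rlt_div_l; lra. }
  assert (Hm : 0 < m) by (unfold m; lra).
  set (g := fun phi => m * (1 + e * sin phi)).
  assert (E1 : x1 = m * (1 - e)) by (unfold m, e; field; lra).
  assert (E2 : x2 = m * (1 + e)) by (unfold m, e; field; lra).
  assert (G1 : g (- (PI / 2)) = x1)
    by (unfold g; rewrite sin_neg, sin_PI2, E1; ring).
  assert (G2 : g (PI / 2) = x2) by (unfold g; rewrite sin_PI2, E2; ring).
  assert (Hs : 0 < sqrt (1 - e ^ 2)) by (apply sqrt_lt_R0; nra).
  assert (Hss : sqrt (1 - e ^ 2) * sqrt (1 - e ^ 2) = 1 - e ^ 2)
    by (apply sqrt_sqrt; nra).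
  assert (Esq : sqrt (x1 * x2) = m * sqrt (1 - e ^ 2)).
  { rewrite E1, E2. replace (m * (1 - e) * (m * (1 + e)))
      with (m ^ 2 * (1 - e ^ 2)) by ring.
    rewrite sqrt_mult by nra. rewrite sqrt_pow2 by lra. reflexivity. }
  (* The pulled-back integrand is [m] times [e ^ 2 * cos phi ^ 2 / (1 + e * sin phi)]; its numerator
     is [(1 - e ^ 2 * sin phi ^ 2) - (1 - e ^ 2)]. *)
  apply (is_RInt_subst _ g (fun phi => m * (e * cos phi))
    (fun phi => m * ((1 - e * sin phi)
                     - (1 - e ^ 2) * / (1 + e * sin phi)))
      (- (PI / 2)) (PI / 2) _ _ _ G1 G2).
  - lra.
  - intros phi _. assert (Hsin := SIN_bound phi).
    assert (0 < g phi) by (unfold g; apply Rmult_lt_0_compat; nra).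
    apply (continuous_mult (fun x => sqrt ((x2 - x) * (x - x1)))).
    + apply continuous_comp; [|apply continuous_sqrt].
      apply (ex_derive_continuous (fun x => (x2 - x) * (x - x1))). auto_derive. auto.
    + apply (ex_derive_continuous Rinv). auto_derive. lra.
  - intros phi _. split.
    + unfold g. auto_derive; auto; ring.
    + apply (ex_derive_continuous (fun phi => m * (e * cos phi))). auto_derive. auto.
  - intros phi Hphi. assert (Hsin := SIN_bound phi).
    assert (Hc : 0 < cos phi) by (apply cos_gt_0; lra).
    assert (Hsc := sin2_cos2 phi). unfold Rsqr in Hsc.
    replace (sqrt _) with (m * e * cos phi).
    2: { symmetry. rewrite E1, E2. unfold g.
      replace (_ * _) with ((m * e * cos phi) ^ 2).
      apply sqrt_pow2. nra.
      transitivity ((m * e) ^ 2 * (cos phi * cos phi)). ring.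
      replace (cos phi * cos phi) with (1 - sin phi * sin phi) by lra. ring. }
    assert (0 < 1 + e * sin phi) by nra.
    unfold g. field_simplify_eq; [|lra].
    replace (cos phi ^ 2) with (1 - sin phi * sin phi) by lra. ring.
  - replace (PI * (m - sqrt (x1 * x2)))
      with (m * (PI - (1 - e ^ 2) * (PI / sqrt (1 - e ^ 2)))).
    2: { rewrite Esq, <- Hss at 1. field. lra. }
    apply is_RInt_Rmult.
    apply is_RInt_Rminus.
    + evar_last.
      * apply (is_RInt_derive (fun x => x + e * cos x)).
        -- intros x _. auto_derive; auto; ring.
        -- intros x _. apply (ex_derive_continuous (fun x => 1 - e * sin x)).
           auto_derive; auto.
      * rewrite cos_neg. unfold minus, plus, opp; simpl. field.
    + apply is_RInt_Rmult, is_RInt_inv_one_plus_sin. lra.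
Qed.

Lemma is_derive_asin (x : R) : -1 < x < 1 ->
  is_derive asin x (/ sqrt (1 - x ^ 2)).
Proof.
  intros Hx. apply is_derive_Reals.
  replace (/ sqrt (1 - x ^ 2)) with (derive_pt asin x (derivable_pt_asin x Hx)).
  - apply derive_pt_eq_1 with (pr := derivable_pt_asin x Hx). reflexivity.
  - rewrite derive_pt_asin. unfold Rsqr, Rdiv. rewrite Rmult_1_l.
    do 3 f_equal. ring.
Qed.

Lemma continuous_polar_integrand (a d b th : R) : 0 < th < PI ->
  continuous (fun th => sqrt (a + d * sin th ^ 2 - b / sin th ^ 2)) th.
Proof.
  intros Hth. assert (Hs := sin_gt_0 th (proj1 Hth) (proj2 Hth)).
  apply (continuous_comp (fun th => a + d * sin th ^ 2 - b / sin th ^ 2));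
    [|apply continuous_sqrt].
  apply (ex_derive_continuous (fun th => a + d * sin th ^ 2 - b / sin th ^ 2)).
  auto_derive. nra.
Qed.

(* Substitution cos th = - c sin phi, with sqrt (1 - c^2) the sine of the
   turning points. *)
Lemma RInt_polar_base (a c : R) : 0 < a -> 0 < c < 1 ->
  RInt (fun th => sqrt (a - a * (1 - c ^ 2) / sin th ^ 2))
    (PI / 2 - asin c) (PI / 2 + asin c)
  = PI * (sqrt a * (1 - sqrt (1 - c ^ 2))).
Proof.
  intros Ha Hc.
  assert (Hpi := PI_RGT_0).
  set (g := fun phi => PI / 2 + asin (c * sin phi)).
  assert (G1 : g (- (PI / 2)) = PI / 2 - asin c).
  { unfold g. rewrite sin_neg, sin_PI2.
    replace (c * - (1)) with (- c) by ring. rewrite asin_opp. ring. }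
  assert (G2 : g (PI / 2) = PI / 2 + asin c).
  { unfold g. rewrite sin_PI2, Rmult_1_r. reflexivity. }
  assert (Hs : 0 < sqrt (1 - c ^ 2)) by (apply sqrt_lt_R0; nra).
  assert (Hss : sqrt (1 - c ^ 2) * sqrt (1 - c ^ 2) = 1 - c ^ 2)
    by (apply sqrt_sqrt; nra).
  assert (Hcs : forall phi, -1 < c * sin phi < 1).
  { intros phi. assert (Hsin := SIN_bound phi). nra. }
  assert (Hcs2 : forall phi, 0 < 1 - (c * sin phi) ^ 2).
  { intros phi. specialize (Hcs phi). nra. }
  assert (Hsg : forall phi, sin (g phi) = sqrt (1 - (c * sin phi) ^ 2)).
  { intros phi. unfold g. specialize (Hcs phi).
    rewrite <- cos_shift. replace (PI / 2 - _) with (- asin (c * sin phi)) by ring.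
    rewrite cos_neg, cos_asin by lra. f_equal. unfold Rsqr. ring. }
  (* Here the pulled-back integrand is [sqrt a * (1 - (1 - c ^ 2) / (1 - c ^ 2 * sin phi ^ 2))];
     partial fractions leave the elementary integral with parameters [c] and [- c]. *)
  apply (is_RInt_subst _ g
    (fun phi => c * cos phi * / sqrt (1 - (c * sin phi) ^ 2))
    (fun phi => sqrt a * (1 - (1 - c ^ 2) / 2 *
      (/ (1 + c * sin phi) + / (1 + - c * sin phi))))
      (- (PI / 2)) (PI / 2) _ _ _ G1 G2).
  - lra.
  - intros phi _.
    apply (continuous_ext (fun th => sqrt (a + 0 * sin th ^ 2 - a * (1 - c ^ 2) / sin th ^ 2))).
    { intros x. f_equal. ring. }
    apply continuous_polar_integrand.
    destruct (asin_bound_lt _ (Hcs phi)). unfold g. lra.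
  - intros phi _. split.
    + unfold g. evar_last.
      * apply (is_derive_plus (fun _ => PI / 2)). apply is_derive_const.
        apply (is_derive_comp asin (fun phi => c * sin phi)).
        apply is_derive_asin, Hcs. auto_derive; auto.
      * unfold plus, zero, scal; simpl; unfold mult; simpl. ring.
    + specialize (Hcs2 phi).
      apply (continuous_mult (fun phi => c * cos phi)
        (fun phi => / sqrt (1 - (c * sin phi) ^ 2))).
      * apply (ex_derive_continuous (fun phi => c * cos phi)). auto_derive; auto.
      * apply (ex_derive_continuous (fun phi => / sqrt (1 - (c * sin phi) ^ 2))).
        auto_derive. replace (1 - c * sin phi * (c * sin phi * 1))
          with (1 - (c * sin phi) ^ 2) by ring.
        repeat split; auto. apply Rgt_not_eq, sqrt_lt_R0, Hcs2.
  - intros phi Hphi. rewrite Hsg.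
    specialize (Hcs phi). specialize (Hcs2 phi).
    assert (Hcp : 0 < cos phi) by (apply cos_gt_0; lra).
    assert (Hsc := sin2_cos2 phi). unfold Rsqr in Hsc.
    set (r := sqrt (1 - (c * sin phi) ^ 2)).
    assert (Hr : 0 < r) by (apply sqrt_lt_R0; lra).
    assert (Hrr : r ^ 2 = 1 - (c * sin phi) ^ 2).
    { unfold r. apply pow2_sqrt. lra. }
    replace (a - a * (1 - c ^ 2) / r ^ 2) with (a * (c * cos phi / r) ^ 2).
    2: { apply (Rmult_eq_reg_r (r ^ 2)); [|nra].
      field_simplify; [|lra|lra]. rewrite Hrr.
      replace (cos phi ^ 2) with (1 - sin phi * sin phi) by lra. ring. }
    rewrite sqrt_mult, sqrt_pow2.
    2: { apply Rlt_le, Rdiv_lt_0_compat; nra. }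
    2: lra. 2: apply pow2_ge_0.
    apply (Rmult_eq_reg_l (r ^ 2)); [|nra].
    transitivity (sqrt a * (c ^ 2 * cos phi ^ 2)). { field. lra. }
    replace (cos phi ^ 2) with (1 - sin phi * sin phi) by lra.
    rewrite Hrr. field. lra.
  - replace (PI * (sqrt a * (1 - sqrt (1 - c ^ 2)))) with
      (sqrt a * (PI - (1 - c ^ 2) / 2 *
        (PI / sqrt (1 - c ^ 2) + PI / sqrt (1 - (- c) ^ 2)))).
    2: { replace ((- c) ^ 2) with (c ^ 2) by ring. rewrite <- Hss at 1. field. lra. }
    apply is_RInt_Rmult.
    apply is_RInt_Rminus.
    + evar_last. apply is_RInt_const.
      unfold scal; simpl; unfold mult; simpl. field.
    + apply is_RInt_Rmult.
      apply is_RInt_Rplus;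
      apply is_RInt_inv_one_plus_sin; lra.
Qed.

Lemma asin_pos (c : R) : 0 < c < 1 -> 0 < asin c.
Proof.
  intros Hc. assert (Hlt := asin_bound_lt c ltac:(lra)). assert (Hpi := PI_RGT_0).
  destruct (Rlt_or_le 0 (asin c)) as [H|H]; auto.
  assert (0 <= sin (- asin c)) by (apply sin_ge_0; lra).
  rewrite sin_neg, sin_asin in H0 by lra. lra.
Qed.

(** Taking [1 - c ^ 2 = b ^ 2 / a] in the preceding integral turns [sqrt a * sqrt (1 - c ^ 2)] into
    [Rabs b]. The endpoint is described by its squared sine, the quantity in which turning points
    for different [d] are compared. *)
Lemma RInt_polar_exact (a b : R) : 0 < b ^ 2 < a ->
  exists t, 0 < t < PI / 2 /\ sin t ^ 2 = b ^ 2 / a /\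
    RInt (fun th => sqrt (a - b ^ 2 / sin th ^ 2)) t (PI - t)
    = PI * (sqrt a - Rabs b).
Proof.
  intros Hb.
  assert (Hq : 0 < b ^ 2 / a < 1).
  { split; [apply Rdiv_lt_0_compat; lra|apply Rlt_div_l; lra]. }
  set (c := sqrt (1 - b ^ 2 / a)).
  assert (Hc2 : c ^ 2 = 1 - b ^ 2 / a) by (apply pow2_sqrt; lra).
  assert (Hc0 : 0 < c) by (apply sqrt_lt_R0; lra).
  assert (Hc : 0 < c < 1) by (split; nra).
  assert (Hsa : 0 < sqrt a) by (apply sqrt_lt_R0; lra).
  exists (PI / 2 - asin c).
  assert (Hlt := asin_bound_lt c ltac:(lra)).
  assert (Hpos := asin_pos c Hc).
  split; [lra|split].
  - rewrite sin_shift, cos_asin by lra.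
    rewrite pow2_sqrt; unfold Rsqr; lra.
  - replace (PI - (PI / 2 - asin c)) with (PI / 2 + asin c) by field.
    assert (Hr : a * (1 - c ^ 2) = b ^ 2) by (rewrite Hc2; field; lra).
    assert (HJ : PI * (sqrt a * (1 - sqrt (1 - c ^ 2))) = PI * (sqrt a - Rabs b)).
    { replace (1 - c ^ 2) with (b ^ 2 / a) by lra.
      rewrite sqrt_div_alt by lra.
      replace (sqrt (b ^ 2)) with (Rabs b).
      - field. lra.
      - rewrite <- sqrt_Rsqr_abs. f_equal. unfold Rsqr. ring. }
    rewrite <- HJ, <- RInt_polar_base, Hr by lra. reflexivity.
Qed.

(** * Bracketing the polar action *)

Lemma ex_RInt_continuous_le (f : R -> R) (a b : R) : a <= b ->
  (forall x, a <= x <= b -> continuous f x) -> ex_RInt f a b.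
Proof.
  intros Hab Hf. apply (ex_RInt_continuous (V := R_CompleteNormedModule)).
  intros x. rewrite Rmin_left, Rmax_right by lra. apply Hf.
Qed.

Lemma RInt_subinterval_le (f : R -> R) (a a' b' b : R) :
  a <= a' -> a' <= b' -> b' <= b ->
  (forall x, a <= x <= b -> continuous f x) ->
  (forall x, a <= x <= b -> 0 <= f x) ->
  RInt f a' b' <= RInt f a b.
Proof.
  intros Ha Hab Hb Hc Hp.
  assert (E : forall u v, a <= u -> u <= v -> v <= b -> ex_RInt f u v).
  { intros u v Hu Huv Hv. apply ex_RInt_continuous_le; auto.
    intros x Hx. apply Hc. lra. }
  rewrite <- (RInt_Chasles f a a' b) by (apply E; lra).
  rewrite <- (RInt_Chasles f a' b' b) by (apply E; lra).
  unfold plus; simpl.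
  assert (0 <= RInt f a a') by (apply RInt_ge_0; [lra|apply E; lra|intros; apply Hp; lra]).
  assert (0 <= RInt f b' b) by (apply RInt_ge_0; [lra|apply E; lra|intros; apply Hp; lra]).
  lra.
Qed.

Lemma sin_sq_le_inv (t u : R) : 0 < t <= PI / 2 -> 0 < u <= PI / 2 ->
  sin t ^ 2 <= sin u ^ 2 -> t <= u.
Proof.
  intros Ht Hu H. assert (Hpi := PI_RGT_0).
  destruct (Rle_or_lt t u) as [|Hlt]; auto.
  assert (sin u < sin t) by (apply sin_increasing_1; lra).
  assert (0 < sin u) by (apply sin_gt_0; lra). nra.
Qed.

(* Dropping the term [d * sin th ^ 2], respectively replacing it by [d],
   brackets the integral between two exact values. *)
Lemma RInt_polar_bounds (a d b t : R) :
  0 <= d -> 0 < b ^ 2 < a -> 0 < t < PI / 2 ->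
  a + d * sin t ^ 2 - b ^ 2 / sin t ^ 2 = 0 ->
  PI * (sqrt a - Rabs b)
  <= RInt (fun th => sqrt (a + d * sin th ^ 2 - b ^ 2 / sin th ^ 2)) t (PI - t)
  <= PI * (sqrt (a + d) - Rabs b).
Proof.
  intros Hd Hb Ht Hz. assert (Hpi := PI_RGT_0).
  assert (Hst : 0 < sin t) by (apply sin_gt_0; lra).
  assert (Hz' : d * (sin t ^ 2) ^ 2 + a * sin t ^ 2 = b ^ 2).
  { apply (f_equal (fun z => z * sin t ^ 2)) in Hz. field_simplify in Hz; [|lra]. nra. }
  assert (Hst1 := SIN_bound t).
  assert (Hcont : forall d' x y th, 0 < x -> y < PI -> x <= th <= y ->
    continuous (fun th => sqrt (a + d' * sin th ^ 2 - b ^ 2 / sin th ^ 2)) th).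
  { intros. apply continuous_polar_integrand. lra. }
  assert (Hcont' : forall a' x y th, 0 < x -> y < PI -> x <= th <= y ->
    continuous (fun th => sqrt (a' - b ^ 2 / sin th ^ 2)) th).
  { intros. apply (continuous_ext (fun th => sqrt (a' + 0 * sin th ^ 2 - b ^ 2 / sin th ^ 2))).
    intros z; f_equal; ring. apply continuous_polar_integrand. lra. }
  destruct (RInt_polar_exact a b Hb) as (ta & Hta & Hsa & <-).
  destruct (RInt_polar_exact (a + d) b ltac:(lra)) as (tu & Htu & Hsu & <-).
  set (X := sin t ^ 2) in *.
  assert (HX : 0 < X <= 1).
  { split; [apply pow_lt; lra|]. rewrite <- (pow1 2). apply pow_incr; lra. }
  assert (HdX : 0 <= d * X ^ 2 <= d * X).
  { split; [apply Rmult_le_pos; [lra|apply pow2_ge_0]|].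
    apply Rmult_le_compat_l; [lra|]. nra. }
  (* Since [d * X ^ 2 + a * X = b ^ 2] and [0 <= d * X ^ 2 <= d * X], [X] lies between
     [b ^ 2 / (a + d)] and [b ^ 2 / a]: the three intervals of integration are nested. *)
  assert (L1 : t <= ta).
  { apply sin_sq_le_inv; try lra. fold X. rewrite Hsa.
    apply (Rle_div_r X (b ^ 2) a); lra. }
  assert (L2 : tu <= t).
  { apply sin_sq_le_inv; try lra. fold X. rewrite Hsu.
    apply (Rle_div_l (b ^ 2) X (a + d)); lra. }
  split.
  - eapply Rle_trans; [|apply (RInt_subinterval_le _ _ ta (PI - ta))]; try lra.
    + apply RInt_le; try lra.
      * apply ex_RInt_continuous_le; [lra|]. intros; apply (Hcont' a ta (PI - ta)); lra.
      * apply ex_RInt_continuous_le; [lra|]. intros; apply (Hcont d ta (PI - ta)); lra.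
      * intros th _. apply sqrt_le_1_alt. assert (0 <= sin th ^ 2) by apply pow2_ge_0. nra.
    + intros; apply (Hcont d t (PI - t)); lra.
    + intros; apply sqrt_pos.
  (* Outside [[t, PI - t]] the radicand is negative and [sqrt] returns 0, so the integrand stays
     continuous and nonnegative on the larger interval. *)
  - eapply Rle_trans; [apply (RInt_subinterval_le _ tu _ _ (PI - tu))|]; try lra.
    + intros; apply (Hcont d tu (PI - tu)); lra.
    + intros; apply sqrt_pos.
    + apply RInt_le; try lra.
      * apply ex_RInt_continuous_le; [lra|]. intros; apply (Hcont d tu (PI - tu)); lra.
      * apply ex_RInt_continuous_le; [lra|]. intros; apply (Hcont' (a + d) tu (PI - tu)); lra.
      * intros th _. apply sqrt_le_1_alt. assert (Hb1 := SIN_bound th).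
        assert (sin th ^ 2 <= 1) by nra. nra.
Qed.

Lemma polar_fun_sin (alpha beta lam eps th : R) : sin th <> 0 ->
  lam ^ 2 - polar_fun alpha beta lam eps th
  = lam ^ 2 + 2 * alpha * eps * lambda_z alpha beta lam eps - alpha ^ 2
    + alpha ^ 2 * (1 - eps ^ 2) * sin th ^ 2
    - lambda_z alpha beta lam eps ^ 2 / sin th ^ 2.
Proof.
  intros Hs. unfold polar_fun.
  replace (cos th ^ 2) with (1 - sin th ^ 2).
  - field. auto.
  - assert (H := sin2_cos2 th). unfold Rsqr in H. lra.
Qed.

(** [theta12] is a choice, meaningful only once such a pair exists. In [S = sin th ^ 2] the equation
    reads [d * S ^ 2 + a * S = b ^ 2], which has one positive root; that root is below 1, and the
    corresponding sine is attained at two angles. *)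
Lemma polar_turning_points_exist (alpha beta lam eps : R) :
  let b := lambda_z alpha beta lam eps in
  let a := lam ^ 2 + 2 * alpha * eps * b - alpha ^ 2 in
  0 <= alpha ^ 2 * (1 - eps ^ 2) -> 0 < b ^ 2 < a ->
  exists th1 th2, polar_turning_points alpha beta lam eps th1 th2.
Proof.
  intros b a Hd Hb. assert (Hpi := PI_RGT_0).
  set (d := alpha ^ 2 * (1 - eps ^ 2)) in *.
  set (D := sqrt (a ^ 2 + 4 * d * b ^ 2)).
  assert (HD2 : D ^ 2 = a ^ 2 + 4 * d * b ^ 2) by (apply pow2_sqrt; nra).
  assert (HD : a <= D).
  { unfold D. rewrite <- (sqrt_pow2 a) at 1 by lra. apply sqrt_le_1_alt. nra. }
  (* The quadratic formula in rationalised form, which remains valid for [d = 0]. *)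
  set (S1 := 2 * b ^ 2 / (a + D)).
  assert (HS : 0 < S1 < 1).
  { unfold S1. split; [apply Rdiv_lt_0_compat|apply Rlt_div_l]; lra. }
  assert (HSq : d * S1 ^ 2 + a * S1 = b ^ 2).
  { unfold S1. field_simplify_eq; [|lra].
    rewrite HD2. ring. }
  assert (Hiff : forall th, 0 < th < PI ->
    (polar_fun alpha beta lam eps th = lam ^ 2 <-> sin th = sqrt S1)).
  { intros th Hth. assert (Hs : 0 < sin th) by (apply sin_gt_0; lra).
    assert (E := polar_fun_sin alpha beta lam eps th ltac:(lra)).
    fold b d in E. fold a in E.
    assert (E2 : sin th ^ 2 * (lam ^ 2 - polar_fun alpha beta lam eps th)
      = (sin th ^ 2 - S1) * (d * (sin th ^ 2 + S1) + a)).
    { rewrite E. rewrite <- HSq. field. lra. }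
    assert (0 <= d * (sin th ^ 2 + S1)).
    { apply Rmult_le_pos; [lra|]. assert (Hp := pow2_ge_0 (sin th)). lra. }
    split.
    - intros H0. rewrite <- (sqrt_pow2 (sin th)) by lra. f_equal.
      rewrite H0, Rminus_diag, Rmult_0_r in E2. symmetry in E2.
      apply Rmult_integral in E2. lra.
    - intros H0. rewrite H0, pow2_sqrt in E2 by lra.
      rewrite Rminus_diag, Rmult_0_l in E2.
      apply Rmult_integral in E2. lra. }
  set (r := sqrt S1) in *.
  assert (Hr : 0 < r < 1).
  { split; [apply sqrt_lt_R0; lra|]. unfold r. rewrite <- sqrt_1. apply sqrt_lt_1; lra. }
  assert (Hlt := asin_bound_lt r ltac:(lra)).
  assert (Hpos := asin_pos r Hr).
  exists (asin r), (PI - asin r). repeat split; try lra.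
  - apply Hiff; [lra|]. apply sin_asin; lra.
  - apply Hiff; [lra|]. rewrite <- sin_PI_x. replace (PI - _) with (asin r) by ring.
    apply sin_asin; lra.
  - intros th Hth H. apply Hiff in H; auto.
    destruct (Rle_or_lt th (PI / 2)).
    + left. rewrite <- H, asin_sin; lra.
    + right. rewrite <- H, <- sin_PI_x, asin_sin; lra.
Qed.

(** The summand [Rabs b] in the action cancels the [- Rabs b] in both bounds on the integral,
    leaving pure square roots. *)
Lemma action2_bounds (alpha beta lam eps : R) :
  let b := lambda_z alpha beta lam eps in
  let a := lam ^ 2 + 2 * alpha * eps * b - alpha ^ 2 in
  0 <= alpha ^ 2 * (1 - eps ^ 2) -> 0 < b ^ 2 < a ->
  sqrt a <= action2 alpha beta lam eps <= sqrt (a + alpha ^ 2 * (1 - eps ^ 2)).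
Proof.
  intros b a Hd Hb. assert (Hpi := PI_RGT_0).
  set (d := alpha ^ 2 * (1 - eps ^ 2)) in *.
  unfold action2. fold b.
  assert (Hspec : polar_turning_points alpha beta lam eps
    (fst (theta12 alpha beta lam eps)) (snd (theta12 alpha beta lam eps))).
  { unfold theta12. apply epsilon_spec.
    destruct (polar_turning_points_exist alpha beta lam eps Hd Hb) as (u & v & H).
    exists (u, v). exact H. }
  destruct (theta12 alpha beta lam eps) as [t1 t2]. cbn [fst snd] in *.
  destruct Hspec as (H1 & H12 & H2 & K1 & K2 & Hu).
  assert (S1 : 0 < sin t1) by (apply sin_gt_0; lra).
  (* At [PI / 2] the radicand is [a + d - b ^ 2 > 0]. Hence [PI - t1], a turning point by symmetry,
     differs from [t1] and must be [t2]. *)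
  assert (Hne : t1 <> PI / 2).
  { intros ->. assert (E := polar_fun_sin alpha beta lam eps (PI / 2) ltac:(lra)).
    fold b d in E. fold a in E. rewrite K1, sin_PI2, pow1, Rdiv_1_r in E. lra. }
  assert (Et : t2 = PI - t1).
  { destruct (Hu (PI - t1)) as [E|E]; try lra.
    rewrite <- K1. unfold polar_fun. rewrite sin_PI_x, Rtrigo_facts.cos_pi_minus. ring. }
  subst t2.
  rewrite (RInt_ext _ (fun th => sqrt (a + d * sin th ^ 2 - b ^ 2 / sin th ^ 2))).
  2: { intros th. rewrite Rmin_left, Rmax_right by lra. intros Hth. f_equal.
    apply polar_fun_sin. apply Rgt_not_eq, sin_gt_0; lra. }
  assert (Hz : a + d * sin t1 ^ 2 - b ^ 2 / sin t1 ^ 2 = 0).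
  { assert (E := polar_fun_sin alpha beta lam eps t1 ltac:(lra)).
    fold b d in E. fold a in E. lra. }
  destruct (RInt_polar_bounds a d b t1 Hd Hb ltac:(lra) Hz) as [L U].
  set (J := RInt _ _ _) in *.
  split.
  - apply (Rmult_le_reg_l PI); [lra|]. field_simplify; lra.
  - apply (Rmult_le_reg_l PI); [lra|]. field_simplify; lra.
Qed.

(** * Energy and Carter constant from the radial turning points *)

Lemma orbit_parameters_turning (alpha beta lam eps p e : R) :
  orbit_parameters alpha beta lam eps p e ->
  -1 < beta < 1 /\ 0 < lam /\ eps < 1 /\ 0 < p /\ 0 < e < 1 /\
  w alpha beta lam (p / (1 + e)) = eps /\ w alpha beta lam (p / (1 - e)) = eps.
Proof.
  intros ((Hb & lms & xa & xi & (Hl0 & _) & Hl & _ & _ & He) & Hp & Hee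
    & xa' & xi' & _ & _ & _ & W1 & W2 & _).
  assert (Hm := Rmin_l 1 (w alpha beta lam xa)).
  repeat split; lra.
Qed.

(** For [x >= 2] the radicand in [w] is nonnegative, so squaring is faithful. [radial_fun] no longer
    sees the sign of the square root; the inequality retains it and later excludes [eps <= 0]. *)
Lemma turning_point_radial_fun (alpha beta lam eps x : R) : 2 <= x ->
  w alpha beta lam x = eps ->
  radial_fun alpha beta lam eps x = 0 /\ alpha * beta * lam / x ^ 2 <= eps.
Proof.
  intros Hx <-. unfold w, radial_fun.
  set (Y := (1 - 2 / x + alpha ^ 2 / x ^ 2) * (1 + lam ^ 2 / x ^ 2)).
  assert (HY : Y * x ^ 4 = (x ^ 2 - 2 * x + alpha ^ 2) * (x ^ 2 + lam ^ 2))
    by (unfold Y; field; lra).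
  assert (H0 : 0 <= Y).
  { apply (Rmult_le_reg_r (x ^ 4)); [apply pow_lt; lra|].
    rewrite Rmult_0_l, HY. apply Rmult_le_pos; nra. }
  assert (HS := sqrt_pos Y). assert (HS2 := pow2_sqrt Y H0).
  split; [|lra].
  rewrite <- HY. transitivity ((sqrt Y ^ 2 - Y) * x ^ 4).
  - field. lra.
  - rewrite HS2. ring.
Qed.

(* A quartic vanishing at [x1] and [x2] whose two lowest coefficients agree
   with those of the product has remainder [x ^ 2] times a linear function
   vanishing at both points. *)
Lemma radial_fun_factor (alpha beta lam eps x1 x2 b c : R) :
  let kap := 1 - eps ^ 2 in
  0 < x1 < x2 ->
  c * (x1 * x2) = alpha ^ 2 * lam ^ 2 * (1 - beta ^ 2) ->
  b * (x1 * x2) = c * (x1 + x2) - 2 * lam ^ 2 ->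
  radial_fun alpha beta lam eps x1 = 0 ->
  radial_fun alpha beta lam eps x2 = 0 ->
  kap * (x1 + x2) = 2 + b /\
  kap * (x1 * x2)
  = lam ^ 2 + alpha ^ 2 + 2 * alpha * beta * eps * lam + b * (x1 + x2) - c /\
  (forall x, radial_fun alpha beta lam eps x
     = (x2 - x) * (x - x1) * (kap * x ^ 2 + b * x + c)).
Proof.
  intros kap Hx Hc Hb R1 R2.
  set (L := 2 + b - kap * (x1 + x2)).
  set (M := kap * (x1 * x2)
    - (lam ^ 2 + alpha ^ 2 + 2 * alpha * beta * eps * lam) - b * (x1 + x2) + c).
  assert (E : forall x, radial_fun alpha beta lam eps x
     = (x2 - x) * (x - x1) * (kap * x ^ 2 + b * x + c) + x ^ 2 * (L * x + M)).
  { intros x. transitivity (- kap * x ^ 4 + 2 * x ^ 3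
      - (lam ^ 2 + alpha ^ 2 + 2 * alpha * beta * eps * lam) * x ^ 2
      + (2 * lam ^ 2) * x - alpha ^ 2 * lam ^ 2 * (1 - beta ^ 2)).
    - unfold radial_fun, kap. ring.
    - rewrite <- Hc. replace (2 * lam ^ 2) with (c * (x1 + x2) - b * (x1 * x2)) by lra.
      unfold L, M. ring. }
  assert (E1 : L * x1 + M = 0).
  { rewrite (E x1) in R1. apply (Rmult_eq_reg_l (x1 ^ 2)); [|apply pow_nonzero; lra].
    rewrite Rmult_0_r, <- R1. ring. }
  assert (E2 : L * x2 + M = 0).
  { rewrite (E x2) in R2. apply (Rmult_eq_reg_l (x2 ^ 2)); [|apply pow_nonzero; lra].
    rewrite Rmult_0_r, <- R2. ring. }
  assert (HL : L = 0).
  { apply (Rmult_eq_reg_r (x2 - x1)); [|lra]. lra. }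
  assert (HM : M = 0) by (rewrite HL in E1; lra).
  split; [unfold L in HL; lra|]. split; [unfold M in HM; lra|].
  intros x. rewrite E, HL, HM. ring.
Qed.

(** A perturbation of [y ^ 2 = 1] for [y = lam * mu]. The bound on [s], which stands for
    [alpha * beta * eps], involves [y] because the only lower bound on [eps] available at that stage
    does; the smallness of [mu] absorbs these terms into [y] and [y ^ 2]. *)
Lemma scaled_momentum_bounds (y mu s t a : R) :
  0 < y -> 0 < mu <= / 100 -> -4 * mu ^ 2 <= t <= 0 -> 0 <= a <= mu ^ 2 ->
  Rabs s <= 1 + 4 * (y * mu ^ 3) ->
  y ^ 2 * (1 + t) = 1 - a - 2 * s * (y * mu) -> / 2 <= y <= 2.
Proof.
  intros Hy Hmu Ht Ha Hs E.
  assert (Hm : 0 < mu ^ 2 <= / 10000) by nra.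
  assert (Hm3 : 0 < mu ^ 3 <= / 1000000) by (simpl; simpl in Hm; nra).
  assert (Hym : 0 < y * mu <= y / 100) by nra.
  assert (H3 : 0 < y * mu ^ 3 <= y / 1000000) by nra.
  assert (HA : Rabs (s * (y * mu)) <= y / 100 + y ^ 2 / 1000000).
  { rewrite Rabs_mult, (Rabs_pos_eq (y * mu)) by lra.
    apply Rle_trans with ((1 + 4 * (y / 1000000)) * (y / 100)); [|nra].
    apply Rmult_le_compat; try lra. apply Rabs_pos. }
  apply Rabs_le_between in HA.
  assert (Hty : - (y ^ 2 / 1000) <= y ^ 2 * t <= 0) by (assert (0 < y ^ 2) by nra; nra).
  replace (2 * s * (y * mu)) with (2 * (s * (y * mu))) in E by ring.
  set (A := s * (y * mu)) in *.
  split.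
  - destruct (Rle_or_lt (/ 2) y); auto. assert (y ^ 2 <= / 4) by nra. lra.
  - destruct (Rle_or_lt y 2); auto. assert (2 * y <= y ^ 2) by nra. lra.
Qed.

(* With [lam = y / mu], the relations between the coefficients pin down
   [y ^ 2 = 1 + O(mu)] and [1 - eps ^ 2 = (1 - e ^ 2) mu ^ 2 (1 + O(mu ^ 2))]. *)
Lemma orbit_estimates (alpha beta lam eps mu e : R) :
  let kap := 1 - eps ^ 2 in
  let x1 := p_of mu / (1 + e) in
  let x2 := p_of mu / (1 - e) in
  0 <= alpha < 1 -> 0 < mu <= / 100 ->
  orbit_parameters alpha beta lam eps (p_of mu) e ->
  -1 < beta < 1 /\ 0 < e < 1 /\ / 2 <= lam * mu <= 2 /\ 0 < eps < 1 /\
  exists b c,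
    Rabs b <= 8 * mu ^ 2 /\ 0 <= c <= 4 * mu ^ 2 /\
    Rabs (b * (x1 + x2) - c) <= 17 /\
    kap = (1 - e ^ 2) * mu ^ 2 * (1 + b / 2) /\
    kap * (x1 + x2) = 2 + b /\
    kap * (x1 * x2)
    = lam ^ 2 + alpha ^ 2 + 2 * alpha * beta * eps * lam + b * (x1 + x2) - c /\
    (forall x, radial_fun alpha beta lam eps x
       = (x2 - x) * (x - x1) * (kap * x ^ 2 + b * x + c)).
Proof.
  intros kap x1 x2 Ha Hmu Hop.
  apply orbit_parameters_turning in Hop.
  fold x1 x2 in Hop.
  destruct Hop as (Hb & Hl & He1 & Hp & He & W1 & W2).
  assert (Hm2 : 0 < mu ^ 2 <= / 10000) by nra.
  assert (Hp4 : p_of mu * mu ^ 2 = 1) by (unfold p_of; field; lra).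
  assert (Hx1 : / 2 <= x1 * mu ^ 2).
  { replace (x1 * mu ^ 2) with (/ (1 + e)).
    - apply Rinv_le_contravar; lra.
    - unfold x1. unfold p_of. field. lra. }
  assert (Hx1b : 2 <= x1) by nra.
  assert (Hx12 : x1 < x2).
  { unfold x1, x2. apply Rmult_lt_compat_l; [lra|].
    apply Rinv_lt_contravar; nra. }
  destruct (turning_point_radial_fun _ _ _ _ _ Hx1b W1) as [R1 Hlow].
  destruct (turning_point_radial_fun _ _ _ _ x2 ltac:(lra) W2) as [R2 _].
  set (y := lam * mu) in *.
  assert (Hy : 0 < y) by (unfold y; nra).
  set (g := alpha ^ 2 * (1 - beta ^ 2)).
  assert (Hg : 0 <= g <= 1).
  { assert (0 <= alpha ^ 2 <= 1) by nra. assert (0 <= 1 - beta ^ 2 <= 1) by nra.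
    unfold g; split; nra. }
  set (k := 1 - e ^ 2).
  assert (Hk : 0 < k < 1) by (unfold k; nra).
  (* [c] and [b] solve the two coefficient equations of [radial_fun_factor], given
     [x1 + x2 = 2 / (mu ^ 2 * k)] and [x1 * x2 = 1 / (mu ^ 4 * k)]. *)
  set (c := g * k * y ^ 2 * mu ^ 2).
  set (b := 2 * c * mu ^ 2 - 2 * k * y ^ 2 * mu ^ 2).
  assert (Hsig : x1 + x2 = 2 / (mu ^ 2 * k)).
  { unfold x1, x2, p_of, k. field. repeat split; nra. }
  assert (Hpi : x1 * x2 = 1 / (mu ^ 4 * k)).
  { unfold x1, x2, p_of, k. field. repeat split; nra. }
  destruct (radial_fun_factor alpha beta lam eps x1 x2 b c) as (F1 & F2 & F3); auto.
  { lra. }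
  { rewrite Hpi. unfold c, g, y. field. lra. }
  { rewrite Hpi, Hsig. unfold b. unfold y. field. lra. }
  fold kap in F1, F2, F3.
  assert (Hkap : kap = k * mu ^ 2 * (1 + b / 2)).
  { rewrite Hsig in F1. transitivity (kap * (2 / (mu ^ 2 * k)) * (mu ^ 2 * k / 2)).
    - field. lra.
    - rewrite F1. field. }
  assert (Hbs : b * (x1 + x2) = 4 * (g * y ^ 2 * mu ^ 2) - 4 * y ^ 2).
  { rewrite Hsig. unfold b, c. field. lra. }
  (* The second relation multiplied by mu ^ 2. *)
  assert (E1 : 1 + b / 2 = y ^ 2 + alpha ^ 2 * mu ^ 2 + 2 * (alpha * beta * eps) * (y * mu)
    + mu ^ 2 * (4 * (g * y ^ 2 * mu ^ 2) - 4 * y ^ 2) - mu ^ 2 * c).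
  { transitivity (mu ^ 2 * (kap * (x1 * x2))).
    - rewrite Hpi, Hkap. field. lra.
    - rewrite F2, Hbs. unfold y. ring. }
  assert (Heps : - (4 * (y * mu ^ 3)) <= eps).
  { apply Rle_trans with (2 := Hlow).
    assert (Hr : 0 < / x1 ^ 2 <= 4 * mu ^ 4).
    { split; [apply Rinv_0_lt_compat, pow_lt; lra|].
      replace (4 * mu ^ 4) with (/ (/ (2 * mu ^ 2)) ^ 2) by (field; lra).
      apply Rinv_le_contravar.
      - apply pow_lt, Rinv_0_lt_compat. lra.
      - apply pow_incr. split; [apply Rlt_le, Rinv_0_lt_compat; lra|].
        replace x1 with (x1 * mu ^ 2 / mu ^ 2) by (field; lra).
        replace (/ (2 * mu ^ 2)) with (/ 2 / mu ^ 2) by (field; lra).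
        apply Rmult_le_compat_r; [apply Rlt_le, Rinv_0_lt_compat; lra|lra]. }
    assert (Hab : -1 <= alpha * beta) by nra.
    replace (4 * (y * mu ^ 3)) with (lam * (4 * mu ^ 4)) by (unfold y; ring).
    assert (H1 : lam * / x1 ^ 2 <= lam * (4 * mu ^ 4)) by (apply Rmult_le_compat_l; lra).
    assert (H2 : 0 <= (1 + alpha * beta) * (lam * / x1 ^ 2)).
    { repeat apply Rmult_le_pos; lra. }
    unfold Rdiv. lra. }
  assert (Hmu3 : 0 < mu ^ 3 <= / 1000000) by (simpl; simpl in Hm2; nra).
  assert (Hym3 : 0 < y * mu ^ 3) by (apply Rmult_lt_0_compat; lra).
  assert (Hab : Rabs (alpha * beta) <= 1) by (apply Rabs_le; nra).
  set (t := mu ^ 2 * (4 * g * mu ^ 2 - 4 - 2 * g * k * mu ^ 2 + k)).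
  assert (Hgk : 0 <= g * k <= g) by nra.
  assert (Hgm : 0 <= g * mu ^ 2 <= mu ^ 2) by nra.
  assert (Hgkm : 0 <= g * k * mu ^ 2 <= g * mu ^ 2) by nra.
  assert (Ht : -4 * mu ^ 2 <= t <= 0).
  { split; unfold t.
    - apply Rle_trans with (mu ^ 2 * (-4)); [lra|]. apply Rmult_le_compat_l; lra.
    - apply Rle_trans with (mu ^ 2 * 0); [|lra]. apply Rmult_le_compat_l; lra. }
  assert (Hy2 : / 2 <= y <= 2).
  { apply (scaled_momentum_bounds y mu (alpha * beta * eps) t (alpha ^ 2 * mu ^ 2)); auto.
    - assert (0 <= alpha ^ 2 <= 1) by nra. nra.
    - rewrite Rabs_mult. rewrite <- (Rmult_1_l (1 + _)).
      apply Rmult_le_compat; try apply Rabs_pos; auto. apply Rabs_le. lra.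
    - unfold t. unfold b, c in E1. lra. }
  assert (Hyy : 0 < y ^ 2 <= 4) by nra.
  assert (Hc0 : 0 <= c <= 4 * mu ^ 2).
  { unfold c. assert (0 <= g * k * y ^ 2 <= 4) by (split; nra). nra. }
  assert (Hky : 0 <= k * y ^ 2 <= 4) by nra.
  assert (Hb8 : Rabs b <= 8 * mu ^ 2).
  { apply Rabs_le. unfold b. split.
    - assert (0 <= c * mu ^ 2) by (apply Rmult_le_pos; lra).
      assert (k * y ^ 2 * mu ^ 2 <= 4 * mu ^ 2) by (apply Rmult_le_compat_r; lra). lra.
    - assert (c * mu ^ 2 <= 4 * mu ^ 2 * 1) by (apply Rmult_le_compat; lra).
      assert (0 <= k * y ^ 2 * mu ^ 2) by (apply Rmult_le_pos; lra). lra. }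
  assert (Hb8' := Hb8). apply Rabs_le_between in Hb8'.
  (* The main part is [4 * y ^ 2 <= 16]; the terms of order [mu ^ 2] fit into the remaining 1. *)
  assert (Hbc : Rabs (b * (x1 + x2) - c) <= 17).
  { apply Rabs_le. rewrite Hbs.
    assert (0 <= y ^ 2 * (g * mu ^ 2) <= 4 * (/ 10000)) by (split; nra). lra. }
  assert (Hkap2 : 0 < kap <= 2 * mu ^ 2).
  { rewrite Hkap. split; [repeat apply Rmult_lt_0_compat; lra|].
    apply Rle_trans with (1 * mu ^ 2 * 2); [|lra].
    apply Rmult_le_compat; try lra.
    - apply Rmult_le_pos; lra.
    - apply Rmult_le_compat_r; lra. }
  (* A nonpositive [eps] would be within [4 * (y * mu ^ 3)] of 0, so [kap] would be close to 1
     instead of at most [2 * mu ^ 2]. *)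
  assert (0 < eps).
  { assert (y * mu ^ 3 <= 2 * (/ 1000000)) by (apply Rmult_le_compat; lra).
    destruct (Rlt_or_le 0 eps); auto. exfalso.
    assert (eps ^ 2 <= / 100) by nra. unfold kap in Hkap2. lra. }
  repeat (split; [first [assumption | lra]|]).
  exists b, c. repeat (split; [first [assumption | lra]|]). assumption.
Qed.

(** * Leading order of the radial action *)

(** [eta] is the relative error in replacing the quadratic factor by [kap * x ^ 2], and [th] the one
    in replacing the denominator by [x ^ 2]. After both replacements the integrand is [sqrt kap]
    times the model one; the square roots are handled by [1 - eta <= sqrt (1 - eta)] and
    [sqrt (1 + eta) <= 1 + eta]. *)
Lemma RInt_radial_bounds (alpha kap b c x1 x2 eta th : R) :
  0 <= alpha < 1 -> 2 <= x1 < x2 -> 0 < kap -> 0 <= eta <= 1 -> 0 <= th < 1 ->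
  (forall x, x1 <= x <= x2 -> Rabs (b * x + c) <= eta * (kap * x ^ 2)) ->
  (forall x, x1 <= x <= x2 -> 2 * x <= th * x ^ 2) ->
  let G := (x1 + x2) / 2 - sqrt (x1 * x2) in
  PI * (sqrt kap * (1 - eta) * G)
  <= RInt (fun x => sqrt ((x2 - x) * (x - x1) * (kap * x ^ 2 + b * x + c))
                    / (x ^ 2 - 2 * x + alpha ^ 2)) x1 x2
  <= PI * (sqrt kap * ((1 + eta) / (1 - th)) * G).
Proof.
  intros Ha Hx Hk Heta Hth Hq Hd G.
  set (f := fun x => sqrt ((x2 - x) * (x - x1)) / x).
  assert (HG : RInt f x1 x2 = PI * G) by (apply RInt_radial_base; lra).
  assert (Cf : ex_RInt f x1 x2).
  { apply ex_RInt_continuous_le; [lra|]. intros x Hx'.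
    apply (continuous_mult (fun x => sqrt ((x2 - x) * (x - x1)))).
    + apply continuous_comp; [|apply continuous_sqrt].
      apply (ex_derive_continuous (fun x => (x2 - x) * (x - x1))). auto_derive. auto.
    + apply (ex_derive_continuous Rinv). auto_derive. lra. }
  assert (HDl : forall x, 2 <= x -> x ^ 2 - 2 * x + alpha ^ 2 <= x ^ 2) by (intros; nra).
  set (h := fun x => sqrt ((x2 - x) * (x - x1) * (kap * x ^ 2 + b * x + c))
                    / (x ^ 2 - 2 * x + alpha ^ 2)).
  assert (HDp : forall x, x1 <= x <= x2 -> (1 - th) * x ^ 2 <= x ^ 2 - 2 * x + alpha ^ 2).
  { intros x Hx'. specialize (Hd x Hx'). nra. }
  assert (HDp0 : forall x, x1 <= x <= x2 -> 0 < x ^ 2 - 2 * x + alpha ^ 2).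
  { intros x Hx'. specialize (HDp x Hx'). assert (0 < (1 - th) * x ^ 2).
    { apply Rmult_lt_0_compat; [lra|apply pow_lt; lra]. } lra. }
  assert (Ch : ex_RInt h x1 x2).
  { apply ex_RInt_continuous_le; [lra|]. intros x Hx'.
    apply (continuous_mult (fun x => sqrt ((x2 - x) * (x - x1) * (kap * x ^ 2 + b * x + c)))).
    + apply continuous_comp; [|apply continuous_sqrt].
      apply (ex_derive_continuous (fun x => (x2 - x) * (x - x1) * (kap * x ^ 2 + b * x + c))).
      auto_derive. auto.
    + apply (ex_derive_continuous (fun x => / (x ^ 2 - 2 * x + alpha ^ 2))).
      auto_derive. specialize (HDp0 x Hx'). lra. }
  assert (Hs : forall x, x1 <= x <= x2 ->
    sqrt kap * (1 - eta) * f x <= h x <= sqrt kap * ((1 + eta) / (1 - th)) * f x).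
  { intros x Hx'. unfold f, h.
    specialize (Hq x Hx'). apply Rabs_le_between in Hq.
    specialize (HDp x Hx'). specialize (HDp0 x Hx').
    assert (HDl' := HDl x ltac:(lra)).
    set (D := x ^ 2 - 2 * x + alpha ^ 2) in *.
    assert (HP : 0 <= (x2 - x) * (x - x1)) by (apply Rmult_le_pos; lra).
    assert (Hkx : 0 < kap * x ^ 2) by (apply Rmult_lt_0_compat; [lra|apply pow_lt; lra]).
    rewrite (sqrt_mult_alt ((x2 - x) * (x - x1)) _ HP).
    set (P := sqrt ((x2 - x) * (x - x1))).
    assert (HP' : 0 <= P) by apply sqrt_pos.
    assert (Hsk : sqrt (kap * x ^ 2) = sqrt kap * x).
    { rewrite sqrt_mult_alt, sqrt_pow2 by lra. reflexivity. }
    assert (Hsk0 := sqrt_pos kap).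
    assert (Q1 : sqrt kap * x * (1 - eta) <= sqrt (kap * x ^ 2 + b * x + c)).
    { rewrite <- Hsk, <- (sqrt_pow2 (1 - eta)) by lra.
      rewrite <- sqrt_mult_alt by lra. apply sqrt_le_1_alt. nra. }
    assert (Q2 : sqrt (kap * x ^ 2 + b * x + c) <= sqrt kap * x * (1 + eta)).
    { rewrite <- Hsk, <- (sqrt_pow2 (1 + eta)) by lra.
      rewrite <- sqrt_mult_alt by lra. apply sqrt_le_1_alt. nra. }
    set (q := sqrt (kap * x ^ 2 + b * x + c)) in *.
    assert (Hx2 : 0 < x ^ 2) by (apply pow_lt; lra).
    split.
    - apply (Rle_div_r _ _ D); [lra|].
      apply Rle_trans with (P * (sqrt kap * x * (1 - eta))).
      + apply Rle_trans with (sqrt kap * (1 - eta) * (P / x) * x ^ 2).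
        * apply Rmult_le_compat_l; [|lra].
          repeat apply Rmult_le_pos; try lra. apply Rlt_le, Rinv_0_lt_compat; lra.
        * right. field. lra.
      + apply Rmult_le_compat_l; lra.
    - apply (Rle_div_l _ _ D); [lra|].
      apply Rle_trans with (P * (sqrt kap * x * (1 + eta))).
      + apply Rmult_le_compat_l; lra.
      + apply Rle_trans with (sqrt kap * ((1 + eta) / (1 - th)) * (P / x) * ((1 - th) * x ^ 2)).
        * right. field. lra.
        * apply Rmult_le_compat_l; [|lra].
          repeat apply Rmult_le_pos; try lra; apply Rlt_le, Rinv_0_lt_compat; lra. }
  assert (Sc : forall r, RInt (fun x => r * f x) x1 x2 = PI * (r * G)).
  { intros r. replace (PI * (r * G)) with (r * (PI * G)) by ring. rewrite <- HG.
    apply is_RInt_unique, is_RInt_Rmult, (RInt_correct (V := R_CompleteNormedModule)), Cf. }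
  assert (Se : forall r, ex_RInt (fun x => r * f x) x1 x2).
  { intros r. exists (r * RInt f x1 x2). apply is_RInt_Rmult.
    apply (RInt_correct (V := R_CompleteNormedModule)), Cf. }
  rewrite <- !Sc. split; apply RInt_le; auto; try lra;
  intros x Hx'; apply Hs; lra.
Qed.

Lemma sqrt_dist (z l r : R) : 0 <= r <= l -> (l - r) ^ 2 <= z <= (l + r) ^ 2 ->
  Rabs (sqrt z - l) <= r.
Proof.
  intros Hr Hz. apply Rabs_le.
  assert (l - r <= sqrt z).
  { rewrite <- (sqrt_pow2 (l - r)) by lra. apply sqrt_le_1_alt. lra. }
  assert (sqrt z <= l + r).
  { rewrite <- (sqrt_pow2 (l + r)) by lra. apply sqrt_le_1_alt. lra. }
  lra.
Qed.

Lemma sqrt_mult_le_mean (u v : R) : 0 <= u -> 0 <= v -> sqrt (u * v) <= (u + v) / 2.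
Proof.
  intros Hu Hv. rewrite <- (sqrt_pow2 ((u + v) / 2)) by lra.
  apply sqrt_le_1_alt. assert (H := pow2_ge_0 (u - v)). lra.
Qed.

(* Only the leading, Keplerian, part [/ sqrt (1 - eps ^ 2)] of the third action
   is needed. *)
Lemma action_estimates (alpha beta lam eps mu e m : R) :
  let kap := 1 - eps ^ 2 in
  let bz := lambda_z alpha beta lam eps in
  0 <= alpha < 1 -> 0 < mu <= / 100 -> 0 < m <= 1 - e ^ 2 -> 240 * mu <= m ^ 2 ->
  orbit_parameters alpha beta lam eps (p_of mu) e ->
  0 < bz ^ 2 < lam ^ 2 + 2 * alpha * eps * bz - alpha ^ 2 ->
  Rabs (action2 alpha beta lam eps - lam) <= 3 /\
  Rabs (action3 alpha beta lam eps (p_of mu / (1 + e)) (p_of mu / (1 - e))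
        - / sqrt kap) <= 9.
Proof.
  intros kap bz Ha Hmu Hm Hmum Hop Hbz.
  destruct (orbit_estimates alpha beta lam eps mu e Ha Hmu Hop)
    as (Hb & He & Hy & Heps & b & c & Hbb & Hc & Hbc & Hk & Hs & Hpi & HR).
  fold kap in Hk, Hs, Hpi, HR.
  set (x1 := p_of mu / (1 + e)) in *. set (x2 := p_of mu / (1 - e)) in *.
  assert (HPI := PI_RGT_0).
  assert (Hl : 50 <= lam).
  { assert (/ 2 <= lam * (/ 100)); [|lra]. apply Rle_trans with (lam * mu); [lra|].
    apply Rmult_le_compat_l; [|lra]. nra. }
  assert (Hal2 : 0 <= alpha ^ 2 <= 1) by nra.
  assert (Heps2 : 0 < eps ^ 2 < 1) by nra.
  assert (Hae : 0 <= alpha * eps <= 1) by nra.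
  assert (Habl : Rabs (bz) <= lam + 1).
  { apply Rabs_le. unfold bz, lambda_z.
    assert (- lam <= beta * lam <= lam) by nra. lra. }
  assert (Hz : Rabs (alpha * eps * bz) <= lam + 1).
  { rewrite Rabs_mult, (Rabs_pos_eq (alpha * eps)) by lra.
    rewrite <- (Rmult_1_l (lam + 1)).
    apply Rmult_le_compat; try lra. apply Rabs_pos. }
  apply Rabs_le_between in Hz.
  assert (Hd : 0 <= alpha ^ 2 * kap <= 1) by (unfold kap; nra).
  destruct (action2_bounds alpha beta lam eps (proj1 Hd) Hbz) as [A1 A2].
  fold bz kap in A1, A2.
  assert (HA2 : Rabs (action2 alpha beta lam eps - lam) <= 3).
  { set (a := lam ^ 2 + 2 * alpha * eps * bz - alpha ^ 2) in *.
    assert (S1 : Rabs (sqrt a - lam) <= 3) by (apply sqrt_dist; unfold a; lra).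
    assert (S2 : Rabs (sqrt (a + alpha ^ 2 * kap) - lam) <= 3)
      by (apply sqrt_dist; unfold a; lra).
    apply Rabs_le_between in S1. apply Rabs_le_between in S2. apply Rabs_le. lra. }
  split; [exact HA2|].
  apply Rabs_le_between in HA2.
  unfold action3.
  assert (Hm2 : 0 < mu ^ 2 <= / 10000) by nra.
  assert (Hbb' := Hbb). apply Rabs_le_between in Hbb'.
  assert (Hkl : m * mu ^ 2 / 2 <= kap).
  { rewrite Hk. apply Rle_trans with (m * mu ^ 2 * (/ 2)); [lra|].
    apply Rmult_le_compat; try lra.
    - apply Rmult_le_pos; lra.
    - apply Rmult_le_compat_r; lra. }
  assert (Hmm : 0 < m * mu ^ 2) by (apply Rmult_lt_0_compat; lra).
  assert (Hmu1 : m <= 1) by nra.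
  assert (Hpos : 0 < p_of mu) by (unfold p_of; apply Rinv_0_lt_compat; lra).
  assert (Hx1 : 1 <= 2 * mu ^ 2 * x1).
  { replace (2 * mu ^ 2 * x1) with (2 * / (1 + e)) by (unfold x1, p_of; field; lra).
    assert (/ 2 <= / (1 + e)) by (apply Rinv_le_contravar; lra). lra. }
  assert (Hx1b : 4 <= x1) by nra.
  assert (Hx12 : x1 < x2).
  { unfold x1, x2. apply Rmult_lt_compat_l; [lra|].
    apply Rinv_lt_contravar; nra. }
  assert (Hxx : forall x, x1 <= x -> 1 <= 2 * mu ^ 2 * x).
  { intros x Hx. apply Rle_trans with (2 * mu ^ 2 * x1); [lra|].
    apply Rmult_le_compat_l; lra. }
  (* On the orbit [1 <= 2 * mu ^ 2 * x], so [kap * x ^ 2 >= m * x / 4], while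
     [Rabs (b * x + c) <= 9 * mu ^ 2 * x]: the ratio is at most [36 * mu ^ 2 / m]. The same
     inequality gives [4 * mu ^ 2] for the denominator. *)
  set (eta := 40 * mu ^ 2 / m).
  assert (Heta0 : eta * m = 40 * mu ^ 2) by (unfold eta; field; lra).
  assert (Hm2p : 0 < m ^ 2) by (apply pow_lt; lra).
  assert (Heta : 40 * mu ^ 2 <= eta <= 1).
  { assert (0 < eta) by (apply Rdiv_lt_0_compat; lra).
    assert (eta * m <= eta * 1) by (apply Rmult_le_compat_l; lra).
    split; [lra|]. apply (Rle_div_l _ _ m); [lra|].
    assert (m ^ 2 <= m) by (clear - Hm Hmu1; nra).
    assert (mu ^ 2 <= mu / 100) by (clear - Hmu; nra). lra. }
  rewrite (RInt_ext _ (fun x => sqrt ((x2 - x) * (x - x1) * (kap * x ^ 2 + b * x + c))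
                    / (x ^ 2 - 2 * x + alpha ^ 2)))
    by (intros x _; rewrite HR; reflexivity).
  assert (Hqb : forall x, x1 <= x <= x2 -> Rabs (b * x + c) <= eta * (kap * x ^ 2)).
  { intros x Hx. specialize (Hxx x (proj1 Hx)).
    apply Rle_trans with (9 * mu ^ 2 * x).
    - eapply Rle_trans; [apply Rabs_triang|].
      rewrite Rabs_mult, (Rabs_pos_eq x), (Rabs_pos_eq c) by lra.
      assert (Rabs b * x <= 8 * mu ^ 2 * x) by (apply Rmult_le_compat_r; lra).
      assert (mu ^ 2 * 4 <= mu ^ 2 * x) by (apply Rmult_le_compat_l; lra). lra.
    - apply Rle_trans with (eta * (m * mu ^ 2 / 2 * x ^ 2)).
      + replace (eta * (m * mu ^ 2 / 2 * x ^ 2)) with ((eta * m) * (mu ^ 2 * x ^ 2) / 2) by field.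
        rewrite Heta0.
        replace (40 * mu ^ 2 * (mu ^ 2 * x ^ 2) / 2) with (10 * mu ^ 2 * x * (2 * mu ^ 2 * x)) by field.
        assert (0 < mu ^ 2 * x) by (apply Rmult_lt_0_compat; lra).
        assert (10 * mu ^ 2 * x * 1 <= 10 * mu ^ 2 * x * (2 * mu ^ 2 * x))
          by (apply Rmult_le_compat_l; lra). lra.
      + apply Rmult_le_compat_l; [lra|]. apply Rmult_le_compat_r; [apply pow2_ge_0|lra]. }
  assert (Hdb : forall x, x1 <= x <= x2 -> 2 * x <= 4 * mu ^ 2 * x ^ 2).
  { intros x Hx. specialize (Hxx x (proj1 Hx)). nra. }
  destruct (RInt_radial_bounds alpha kap b c x1 x2 eta (4 * mu ^ 2)
    Ha ltac:(lra) ltac:(lra) ltac:(lra) ltac:(lra) Hqb Hdb) as [K1 K2].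
  set (J := RInt _ x1 x2) in *.
  set (G := (x1 + x2) / 2 - sqrt (x1 * x2)) in *.
  set (K := / PI * J).
  set (s := sqrt kap) in *.
  assert (Hkp : 0 < kap) by lra.
  assert (Hs0 : 0 < s) by (apply sqrt_lt_R0; lra).
  assert (Hss : s ^ 2 = kap) by (apply pow2_sqrt; lra).
  assert (HK1 : s * (1 - eta) * G <= K).
  { unfold K. apply (Rmult_le_reg_l PI); [lra|]. field_simplify; lra. }
  assert (HG : 0 <= G) by (assert (H := sqrt_mult_le_mean x1 x2 ltac:(lra) ltac:(lra)); unfold G; lra).
  assert (HsG : 0 <= s * G) by (apply Rmult_le_pos; lra).
  assert (HK2 : K <= s * (1 + 2 * eta) * G).
  { apply Rle_trans with (s * ((1 + eta) / (1 - 4 * mu ^ 2)) * G).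
    - unfold K. apply (Rmult_le_reg_l PI); [lra|].
      rewrite <- Rmult_assoc, Rinv_r, Rmult_1_l by lra. lra.
    - apply Rmult_le_compat_r; [lra|]. apply Rmult_le_compat_l; [lra|].
      apply (Rle_div_l _ _ (1 - 4 * mu ^ 2)); [lra|]. clear - Heta Hm2. nra. }
  assert (Hsl : m * mu / 2 <= s).
  { assert (Hmmu : 0 < m * mu) by (apply Rmult_lt_0_compat; lra).
    unfold s. rewrite <- (sqrt_pow2 (m * mu / 2)) by lra.
    apply sqrt_le_1_alt. apply Rle_trans with (m * mu ^ 2 / 2); [|lra].
    replace ((m * mu / 2) ^ 2) with (m * (m * mu ^ 2) / 4) by field.
    clear - Hmm Hmu1. nra. }
  set (z := / s).
  assert (Hz0 : 0 < z) by (apply Rinv_0_lt_compat; lra).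
  assert (Hsz : s * z = 1) by (unfold z; field; lra).
  assert (Hmz : m * (mu * z) <= 2).
  { apply Rle_trans with (2 * (s * z)); [|lra].
    replace (m * (mu * z)) with (2 * (m * mu / 2 * z)) by field.
    assert (m * mu / 2 * z <= s * z) by (apply Rmult_le_compat_r; lra). lra. }
  assert (Hsig : s * (x1 + x2) = (2 + b) * z).
  { rewrite <- Hs, <- Hss. unfold z. field. lra. }
  assert (Hmix : Rabs (s * sqrt (x1 * x2) - lam) <= 3).
  { unfold s. rewrite <- sqrt_mult_alt, Hpi by lra.
    assert (- lam <= beta * lam <= lam) by (clear - Hb Hl; nra).
    assert (- lam <= alpha * eps * (beta * lam) <= lam)
      by (clear - H Hae Hl; nra).
    apply Rabs_le_between in Hbc. apply sqrt_dist; lra. }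
  apply Rabs_le_between in Hmix.
  (* The crucial cancellation: [s * sqrt (x1 * x2)] is within 3 of [lam], so the radial integral
     over [PI] is [z - lam] up to a bounded error, and adding [action2], close to [lam], leaves
     [z = / sqrt kap]. *)
  assert (HsGe : s * G = z + b * z / 2 - s * sqrt (x1 * x2)).
  { unfold G. lra. }
  assert (Hmuz : mu ^ 2 * z <= / 100).
  { apply (Rmult_le_reg_l (m ^ 2)); [lra|].
    replace (m ^ 2 * (mu ^ 2 * z)) with (mu * m * (m * (mu * z))) by ring.
    assert (mu * m <= mu * 1) by (apply Rmult_le_compat_l; lra).
    assert (mu * m * (m * (mu * z)) <= mu * m * 2)
      by (apply Rmult_le_compat_l; [apply Rmult_le_pos|]; lra).
    lra. }
  assert (Hbz1 : Rabs (b * z) <= 1).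
  { rewrite Rabs_mult, (Rabs_pos_eq z) by lra.
    apply Rle_trans with (8 * mu ^ 2 * z); [|lra]. apply Rmult_le_compat_r; lra. }
  apply Rabs_le_between in Hbz1.
  (* The origin of 240: [m ^ 2 * (eta * z)] is at most [80 * mu], a third of [240 * mu]. A relative
     error of order [mu ^ 2] on [z], of order [1 / mu], is thus harmless. *)
  assert (Hez : eta * z <= / 3).
  { apply (Rmult_le_reg_l (m ^ 2)); [lra|].
    replace (m ^ 2 * (eta * z)) with ((eta * m) * m * z) by ring. rewrite Heta0.
    replace (40 * mu ^ 2 * m * z) with (40 * mu * (m * (mu * z))) by ring.
    assert (40 * mu * (m * (mu * z)) <= 40 * mu * 2) by (apply Rmult_le_compat_l; lra).
    lra. }
  assert (Heg : 0 <= eta * (s * G) <= 1).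
  { split; [apply Rmult_le_pos; lra|].
    apply Rle_trans with (eta * (2 * z)); [|lra]. apply Rmult_le_compat_l; [lra|].
    assert (b * z <= 1 * z) by (apply Rmult_le_compat_r; lra). lra. }
  replace (s * (1 - eta) * G) with (s * G - eta * (s * G)) in HK1 by ring.
  replace (s * (1 + 2 * eta) * G) with (s * G + 2 * (eta * (s * G))) in HK2 by ring.
  (* The errors add up to at most [3 + 3 + 1 / 2 + 2 <= 9]. *)
  apply Rabs_le. lra.
Qed.

(** * Expansion of [lam] in the actions *)

(** The product [q = j * s] is within [9 * s] of 1, and the difference equals
    [s ^ 2 * (1 - q ^ 2) / q ^ 2]: a bounded error in [j] gains a factor [s]. *)
Lemma inv_sq_perturbation (j s : R) : 0 < s <= / 50 -> Rabs (j - / s) <= 9 ->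
  Rabs (1 / j ^ 2 - s ^ 2) <= 90 * s ^ 3.
Proof.
  intros Hs Hj. apply Rabs_le_between in Hj.
  assert (H1 : s * / s = 1) by (apply Rinv_r; lra).
  set (q := j * s).
  assert (Hq : - (9 * s) <= q - 1 <= 9 * s).
  { replace (q - 1) with ((j - / s) * s) by (unfold q; field; lra). nra. }
  assert (Hq1 : 82 / 100 <= q) by lra.
  assert (Hj0 : j <> 0) by (intros ->; unfold q in Hq1; lra).
  replace (1 / j ^ 2 - s ^ 2) with (s ^ 2 * ((1 - q ^ 2) / q ^ 2)).
  2: { unfold q. field. split; lra. }
  replace (90 * s ^ 3) with (s ^ 2 * (90 * s)) by ring.
  rewrite Rabs_mult, (Rabs_pos_eq (s ^ 2)) by apply pow2_ge_0.
  apply Rmult_le_compat_l; [apply pow2_ge_0|].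
  assert (Hq2 : 1 / 2 <= q ^ 2) by nra.
  apply Rabs_le. split.
  - apply (Rle_div_r _ _ (q ^ 2)); [lra|]. nra.
  - apply (Rle_div_l _ _ (q ^ 2)); [lra|]. nra.
Qed.

(* Squaring the claimed expansion [T] makes all terms cancel down to the order
   of [mu ^ 2]; dividing [lam ^ 2 - T ^ 2] by [lam + T] gains the last power. *)
Lemma expansion_error (alpha lam eps j1 j2 v rho mu : R) :
  let T := j2 - alpha * j1 / j2
             + alpha ^ 2 / (2 * j2) * (1 - j1 ^ 2 / j2 ^ 2)
             + alpha * j1 / (2 * j2)
               * (v + alpha ^ 2 / j2 ^ 2 * (1 - j1 ^ 2 / j2 ^ 2)) in
  0 <= alpha < 1 -> 0 < mu <= / 100 ->
  / 2 <= lam * mu -> / 3 <= j2 * mu -> Rabs j1 <= j2 -> Rabs j1 * mu <= 3 ->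
  Rabs (2 * (1 - eps) - v) <= 400 * mu ^ 3 -> 0 <= v <= 6 * mu ^ 2 ->
  lam ^ 2 = j2 ^ 2 - 2 * alpha * eps * j1 + alpha ^ 2 + rho ->
  Rabs rho <= 2 * mu ^ 2 ->
  Rabs (lam - T) <= 3000 * mu ^ 3.
Proof.
  intros T Ha Hmu Hl Hj2 Hj1 Hj1m Hv Hv6 Hlam Hrho.
  assert (Hm2 : 0 < mu ^ 2 <= / 10000) by nra.
  assert (Hj2p : 0 < j2) by nra.
  assert (Hlp : 0 < lam) by nra.
  set (i := / j2).
  assert (Hi0 : 0 < i) by (apply Rinv_0_lt_compat; lra).
  assert (Hij : i * j2 = 1) by (apply Rinv_l; lra).
  assert (Hi : i <= 3 * mu).
  { apply (Rmult_le_reg_r j2); [lra|]. lra. }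
  set (g := j1 * i).
  assert (Hg : -1 <= g <= 1).
  { apply Rabs_le_between in Hj1. unfold g. nra. }
  assert (Hg2 : 0 <= 1 - g ^ 2 <= 1) by nra.
  set (t1 := - (alpha * g)).
  set (t2 := alpha ^ 2 * i * (1 - g ^ 2) / 2).
  set (t3 := alpha * g / 2 * (v + alpha ^ 2 * i ^ 2 * (1 - g ^ 2))).
  assert (HT : T = j2 + t1 + t2 + t3).
  { unfold T, t1, t2, t3, g, i. field. lra. }
  assert (Hal2 : 0 <= alpha ^ 2 <= 1) by nra.
  assert (Ht1 : -1 <= t1 <= 1) by (unfold t1; nra).
  assert (Hw : 0 <= alpha ^ 2 * (1 - g ^ 2) <= 1) by nra.
  assert (Ht2 : 0 <= t2 <= 2 * mu).
  { replace t2 with (alpha ^ 2 * (1 - g ^ 2) * i / 2) by (unfold t2; field). nra. }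
  assert (Hi2 : 0 <= i ^ 2 <= 9 * mu ^ 2) by nra.
  assert (Ht3 : Rabs t3 <= 8 * mu ^ 2).
  { replace t3 with (- t1 * ((v + alpha ^ 2 * (1 - g ^ 2) * i ^ 2) / 2))
      by (unfold t3, t1; field).
    assert (0 <= (v + alpha ^ 2 * (1 - g ^ 2) * i ^ 2) / 2 <= 8 * mu ^ 2) by nra.
    rewrite Rabs_mult, Rabs_Ropp, (Rabs_pos_eq (_ / 2)) by lra.
    rewrite <- (Rmult_1_l (8 * mu ^ 2)).
    apply Rmult_le_compat; try lra; try apply Rabs_pos. apply Rabs_le; lra. }
  apply Rabs_le_between in Ht3.
  (* The corrections [t1], [t2], [t3] have orders 1, [mu], [mu ^ 2] and satisfy
     [2 * j2 * t1 = - 2 * alpha * j1], [t1 ^ 2 + 2 * j2 * t2 = alpha ^ 2] and [2 * j2 * t3 + 2 * t1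
     * t2 = alpha * j1 * v]; the products left over are those in the last line. *)
  assert (Hkey : (lam - T) * (lam + T)
    = alpha * (j1 * (2 * (1 - eps) - v)) + rho
      - (2 * (t1 * t3) + t2 ^ 2 + 2 * (t2 * t3) + t3 ^ 2)).
  { transitivity (lam ^ 2 - (j2 + t1 + t2 + t3) ^ 2); [rewrite HT; ring|].
    rewrite Hlam. unfold t1, t2, t3, g, i. field. lra. }
  assert (Hj : Rabs (alpha * (j1 * (2 * (1 - eps) - v))) <= 1200 * mu ^ 2).
  { rewrite !Rabs_mult, (Rabs_pos_eq alpha) by lra.
    set (X := Rabs j1 * Rabs (2 * (1 - eps) - v)).
    assert (HX : 0 <= X <= 1200 * mu ^ 2).
    { unfold X. assert (Hp1 := Rabs_pos j1).
      assert (Hp2 := Rabs_pos (2 * (1 - eps) - v)). split; [nra|].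
      apply Rle_trans with (Rabs j1 * (400 * mu ^ 3)).
      - apply Rmult_le_compat_l; lra.
      - replace (Rabs j1 * (400 * mu ^ 3)) with (400 * mu ^ 2 * (Rabs j1 * mu)) by ring.
        nra. }
    nra. }
  assert (Htot : Rabs ((lam - T) * (lam + T)) <= 1300 * mu ^ 2).
  { rewrite Hkey. apply Rabs_le_between in Hj. apply Rabs_le_between in Hrho.
    clearbody t1 t2 t3.
    assert (- (8 * mu ^ 2) <= t1 * t3 <= 8 * mu ^ 2) by (clear - Ht1 Ht3; nra).
    assert (0 <= t2 ^ 2 <= 4 * mu ^ 2) by (clear - Ht2 Hmu; nra).
    assert (Ht2' : 0 <= t2 <= 1) by lra.
    assert (- (8 * mu ^ 2) <= t2 * t3 <= 8 * mu ^ 2) by (clear - Ht2' Ht3; nra).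
    assert (Ht3' : -1 <= t3 <= 1) by lra.
    assert (0 <= t3 ^ 2 <= 8 * mu ^ 2) by (clear - Ht3 Ht3'; nra).
    apply Rabs_le. lra. }
  assert (HTp : 0 <= T).
  { assert (30 <= j2) by nra. rewrite HT. lra. }
  rewrite Rabs_mult, (Rabs_pos_eq (lam + T)) in Htot by lra.
  assert (Hn := Rabs_pos (lam - T)).
  assert (H1 : Rabs (lam - T) * lam <= 1300 * mu ^ 2).
  { apply Rle_trans with (2 := Htot). apply Rmult_le_compat_l; lra. }
  assert (H2 : Rabs (lam - T) * lam * mu <= 1300 * mu ^ 2 * mu)
    by (apply Rmult_le_compat_r; lra).
  assert (H3 : Rabs (lam - T) * / 2 <= Rabs (lam - T) * (lam * mu))
    by (apply Rmult_le_compat_l; lra).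
  replace (mu ^ 3) with (mu ^ 2 * mu) by ring.
  assert (0 < mu ^ 2 * mu) by (apply Rmult_lt_0_compat; lra).
  lra.
Qed.

Theorem proposition6 :
  forall alpha beta0 beta1 e0 e1 mu1 : R,
  0 <= alpha < 1 ->
  0 < beta0 -> beta0 < beta1 -> beta1 < 1 ->
  0 < e0 -> e0 < e1 -> e1 < 1 ->
  0 < mu1 ->
  (* the action map is defined on (0, mu1) x U0 *)
  (forall mu beta e : R,
     0 < mu < mu1 -> U0 beta0 beta1 e0 e1 beta e ->
     orbit_domain alpha beta (p_of mu) e) ->
  (* the action map is injective on (0, mu1) x U0 *)
  (forall mu beta e mu' beta' e' : R,
     0 < mu < mu1 -> U0 beta0 beta1 e0 e1 beta e ->
     0 < mu' < mu1 -> U0 beta0 beta1 e0 e1 beta' e' ->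
     action_map alpha mu beta e = action_map alpha mu' beta' e' ->
     mu = mu' /\ beta = beta' /\ e = e') ->
  exists C delta : R, 0 < delta /\
  forall j1 j2 j3 mu beta e : R,
    0 < mu < mu1 -> U0 beta0 beta1 e0 e1 beta e ->
    (j1, j2, j3) = action_map alpha mu beta e ->
    mu < delta ->
    Rabs (lambda_of alpha beta (p_of mu) e
          - (j2 - alpha * j1 / j2
             + alpha ^ 2 / (2 * j2) * (1 - j1 ^ 2 / j2 ^ 2)
             + alpha * j1 / (2 * j2)
               * (1 / j3 ^ 2 + alpha ^ 2 / j2 ^ 2 * (1 - j1 ^ 2 / j2 ^ 2))))
    <= C * mu ^ 3.
Proof.
  intros alpha beta0 beta1 e0 e1 mu1 Ha Hb0 Hb01 Hb1 He0 He01 He1 Hmu1 Hdom _.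
  set (m := 1 - e1 ^ 2).
  assert (Hm : 0 < m < 1) by (unfold m; nra).
  set (n := 1 - beta1 ^ 2).
  assert (Hn : 0 < n < 1) by (unfold n; nra).
  (* [m ^ 2 / 240] serves the radial estimate. [beta0 / 2] keeps [lambda_z] away from 0, as [beta0 *
     lam > 2 * mu * lam >= 1 >= alpha * eps]. [n / 8] ensures [bz ^ 2 < a], so that the polar
     turning points exist. *)
  exists 3000, (Rmin (/ 100) (Rmin (m ^ 2 / 240) (Rmin (beta0 / 2) (n / 8)))).
  split.
  { repeat apply Rmin_pos; nra. }
  intros j1 j2 j3 mu beta e Hmu HU Hj Hsmall.
  apply Rmin_Rgt_l in Hsmall. destruct Hsmall as [Hs1 Hsmall].
  apply Rmin_Rgt_l in Hsmall. destruct Hsmall as [Hs2 Hsmall].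
  apply Rmin_Rgt_l in Hsmall. destruct Hsmall as [Hs3 Hs4].
  assert (Hop : orbit_parameters alpha beta (lambda_of alpha beta (p_of mu) e)
    (eps_of alpha beta (p_of mu) e) (p_of mu) e).
  { unfold lambda_of, eps_of, lambda_eps. apply epsilon_spec.
    destruct (Hdom mu beta e Hmu HU) as (l & ep & H). exists (l, ep). exact H. }
  unfold action_map in Hj.
  set (lam := lambda_of alpha beta (p_of mu) e) in *.
  set (eps := eps_of alpha beta (p_of mu) e) in *.
  injection Hj as Ej1 Ej2 Ej3.
  assert (Hmu' : 0 < mu <= / 100) by lra.
  destruct (orbit_estimates alpha beta lam eps mu e Ha Hmu' Hop)
    as (Hb & He & Hy & Heps & b & c & Hbb & _ & _ & Hk & _).
  assert (Hm2 : 0 < mu ^ 2 <= / 10000) by nra.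
  set (kap := 1 - eps ^ 2) in *.
  apply Rabs_le_between in Hbb.
  assert (Hee : m <= 1 - e ^ 2 < 1) by (destruct HU as [_ HU]; clear - He HU He0 He1; unfold m; nra).
  assert (Hkap : 0 < kap <= 2 * mu ^ 2).
  { rewrite Hk. split; [repeat apply Rmult_lt_0_compat; lra|].
    apply Rle_trans with (1 * mu ^ 2 * 2); [|lra].
    apply Rmult_le_compat; try lra.
    - apply Rmult_le_pos; lra.
    - apply Rmult_le_compat_r; lra. }
  assert (Hl : 50 <= lam).
  { assert (/ 2 <= lam * (/ 100)); [|lra]. apply Rle_trans with (lam * mu); [lra|].
    apply Rmult_le_compat_l; [|lra]. clear - Hy Hmu'. nra. }
  assert (Hae : 0 <= alpha * eps <= 1) by (clear - Ha Heps; nra).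
  assert (Hbeta : beta0 <= Rabs beta <= beta1).
  { destruct HU as [[H|H] _].
    - rewrite Rabs_left by lra. lra.
    - rewrite Rabs_pos_eq by lra. lra. }
  assert (Hbeta2 : n <= 1 - beta ^ 2).
  { rewrite <- (pow2_abs beta). unfold n. clear - Hbeta Hb0. nra. }
  set (bz := lambda_z alpha beta lam eps) in *.
  unfold action1 in Ej1. fold bz in Ej1.
  assert (Hbz0 : bz <> 0).
  { intros H0. unfold bz, lambda_z in H0.
    assert (H1 : Rabs (beta * lam) = alpha * eps).
    { replace (beta * lam) with (- (alpha * eps)) by lra.
      rewrite Rabs_Ropp, Rabs_pos_eq; lra. }
    rewrite Rabs_mult, (Rabs_pos_eq lam) in H1 by lra.
    assert (H2 : beta0 * lam <= Rabs beta * lam) by (apply Rmult_le_compat_r; lra).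
    assert (mu * lam < beta0 / 2 * lam) by (apply Rmult_lt_compat_r; lra).
    lra. }
  assert (Hal2 : 0 <= alpha ^ 2 <= 1) by (clear - Ha; nra).
  assert (Hrho : 0 <= alpha ^ 2 * kap <= 2 * mu ^ 2)
    by (clear - Hal2 Hkap; clearbody kap; nra).
  set (a := lam ^ 2 + 2 * alpha * eps * bz - alpha ^ 2).
  assert (Hbza : 0 < bz ^ 2 < a).
  { split; [apply pow2_gt_0; auto|].
    assert (Hdiff : a - bz ^ 2 = lam ^ 2 * (1 - beta ^ 2) - alpha ^ 2 * kap)
      by (unfold a, bz, lambda_z, kap; ring).
    assert (2500 <= lam ^ 2) by (clear - Hl; nra).
    assert (2500 * n <= lam ^ 2 * (1 - beta ^ 2)) by (apply Rmult_le_compat; lra).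
    assert (mu ^ 2 <= mu / 100) by (clear - Hmu'; nra). lra. }
  destruct (action_estimates alpha beta lam eps mu e m Ha Hmu' ltac:(lra) ltac:(lra)
    Hop Hbza) as [Hj2 Hj3].
  fold kap in Hj3. rewrite <- Ej2 in Hj2. rewrite <- Ej3 in Hj3.
  destruct (action2_bounds alpha beta lam eps (proj1 Hrho) Hbza) as [A1 A2].
  fold bz kap in A1, A2. fold a in A1, A2. rewrite <- Ej2 in A1, A2.
  apply Rabs_le_between in Hj2.
  assert (Hj22 : a <= j2 ^ 2 <= a + alpha ^ 2 * kap).
  { assert (Q1 := pow2_sqrt a ltac:(lra)).
    assert (Q2 := pow2_sqrt (a + alpha ^ 2 * kap) ltac:(lra)).
    assert (Q3 := sqrt_pos a).
    rewrite <- Q1 at 1. rewrite <- Q2. split; apply pow_incr; lra. }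
  assert (Hss : 0 < sqrt kap) by (apply sqrt_lt_R0; lra).
  assert (Hs2' : sqrt kap ^ 2 = kap) by (apply pow2_sqrt; lra).
  assert (Hsm : sqrt kap <= 2 * mu).
  { rewrite <- (sqrt_pow2 (2 * mu)) by lra. apply sqrt_le_1_alt.
    replace ((2 * mu) ^ 2) with (4 * mu ^ 2) by ring. lra. }
  assert (Hv := inv_sq_perturbation j3 (sqrt kap) ltac:(lra) Hj3).
  rewrite Hs2' in Hv.
  assert (Hs3' : 90 * sqrt kap ^ 3 <= 360 * mu ^ 3).
  { replace (sqrt kap ^ 3) with (kap * sqrt kap) by (rewrite <- Hs2' at 1; ring).
    replace (360 * mu ^ 3) with (90 * ((2 * mu ^ 2) * (2 * mu))) by ring.
    apply Rmult_le_compat_l; [lra|]. apply Rmult_le_compat; lra. }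
  assert (Hmu3 : 0 < mu ^ 3 <= mu ^ 2 / 100).
  { clear - Hmu' Hm2. replace (mu ^ 3) with (mu * mu ^ 2) by ring. nra. }
  assert (Hv0 : 0 <= 1 / j3 ^ 2).
  { apply Rmult_le_pos; [lra|]. destruct (Req_dec j3 0) as [->|Hj30].
    - rewrite pow_i by auto. rewrite Rinv_0. lra.
    - apply Rlt_le, Rinv_0_lt_compat, pow2_gt_0. auto. }
  apply Rabs_le_between in Hv.
  apply (expansion_error alpha lam eps j1 j2 (1 / j3 ^ 2)
    (lam ^ 2 - (j2 ^ 2 - 2 * alpha * eps * j1 + alpha ^ 2)) mu); auto; try lra.
  - clear - Hy Hj2 Hmu'. nra.
  - rewrite Ej1. apply Rle_trans with (sqrt a); [|lra].
    rewrite <- sqrt_Rsqr_abs. apply sqrt_le_1_alt. unfold Rsqr. lra.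
  - rewrite Ej1. unfold bz, lambda_z.
    apply Rle_trans with ((lam + 1) * mu); [|lra].
    apply Rmult_le_compat_r; [lra|]. apply Rabs_le.
    assert (- lam <= beta * lam <= lam) by (clear - Hb Hl; nra). lra.
  (* Replacing [2 * (1 - eps)] by [kap] costs [(1 - eps) ^ 2 <= kap ^ 2], of order [mu ^ 4]; the
     bound 400 is 360 from [j3] plus a generous 40 for this. *)
  - assert (Heq : 2 * (1 - eps) - kap = (1 - eps) ^ 2) by (unfold kap; ring).
    assert (0 <= 1 - eps <= kap) by (clear - Heps; unfold kap; nra).
    assert (0 <= (1 - eps) ^ 2 <= kap ^ 2)
      by (split; [apply pow2_ge_0|apply pow_incr; lra]).
    assert (kap ^ 2 <= 40 * mu ^ 3).
    { apply Rle_trans with ((2 * mu ^ 2) ^ 2); [apply pow_incr; lra|].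
      replace ((2 * mu ^ 2) ^ 2) with (4 * mu * mu ^ 3) by ring.
      apply Rmult_le_compat_r; lra. }
    apply Rabs_le. lra.
  - rewrite Ej1. apply Rabs_le. unfold a in Hj22. lra.
Qed.
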